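(* Let $p\in[1,\infty]$, let $M\subset\mathbb{R}^m$ be convex and bounded, let $\mathcal{W}=\{w\in L^p(\Omega,\mathbb{R}^m): w(x)\in M \text{ for a.e. } x\in\Omega\}$, and let $G:\Omega\times\mathbb{R}^{2+m}\to\mathbb{R}$, $G=G(x,u,v,w)$, have partial derivatives $G_u,G_v$. For $w\in\mathcal{W}$ define on $\mathbb{H}_0^{\alpha/2}=H_0^{\alpha/2}(\Omega)\times H_0^{\alpha/2}(\Omega)$ the functional $$F_w(u,v)=\int_\Omega\Big(\tfrac12|(-\Delta)^{\alpha/4}v(x)|^2-\tfrac12|(-\Delta)^{\alpha/4}u(x)|^2+G(x,u(x),v(x),w(x))\Big)dx .$$ Assume: (A1) $G,G_u,G_v$ are measurable in $x$ for every $(u,v,w)\in\mathbb{R}^{2+m}$ and continuous in $(u,v,w)$ for a.e. $x\in\Omega$. (A2) There are $s\in(1,2^*_\alpha)$ and $c>0$ such that, for $z\in\{u,v\}$: if $p=\infty$, then $|G(x,u,v,w)|\le c(1+|u|^s+|v|^s)$ and $|G_z(x,u,v,w)|\le c(1+|u|^{s-1}+|v|^{s-1})$ for a.e. $x\in\Omega$ and all $u,v\in\mathbb{R}$, $w\in M$; if $p\in[1,\infty)$, then $|G(x,u,v,w)|\le c(1+|u|^s+|v|^s+|w|^p)$ and $|G_z(x,u,v,w)|\le c(1+|u|^{s-1}+|v|^{s-1}+|w|^{p-p/s})$ for a.e. $x\in\Omega$ and all $u,v\in\mathbb{R}$, $w\in\mathbb{R}^m$. (A3) For every $u\in H_0^{\alpha/2}(\Omega)$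 there exist $b\in\mathbb{R}$ with $\rho_1^{\alpha/2}>2b$, $\beta_1\in L^2(\Omega)$, $\gamma_1\in L^1(\Omega)$ such that $G(x,u(x),v,w)\ge -b|v|^2-\beta_1(x)v-\gamma_1(x)$ for all $v\in\mathbb{R}$, $w\in M$ and a.e. $x\in\Omega$. (A4) For every $v\in H_0^{\alpha/2}(\Omega)$ there exist $B\in\mathbb{R}$ with $\rho_1^{\alpha/2}>2B$, $\beta_2\in L^2(\Omega)$, $\gamma_2\in L^1(\Omega)$ such that $G(x,u,v(x),w)\le B|u|^2+\beta_2(x)u+\gamma_2(x)$ for all $u\in\mathbb{R}$, $w\in M$ and a.e. $x\in\Omega$. (A5) For every $w\in\mathcal{W}$, $F_w(\cdot,v)$ is concave for every $v\in H_0^{\alpha/2}(\Omega)$ and $F_w(u,\cdot)$ is convex for every $u\in H_0^{\alpha/2}(\Omega)$. Then for every $w\in\mathcal{W}$ there exists at least one saddle point $(u_w,v_w)\in\mathbb{H}_0^{\alpha/2}$ of $F_w$. Moreover, there are balls $B_1(0,r_1)\subset H_0^{\alpha/2}(\Omega)$ and $B_2(0,r_2)\subset H_0^{\alpha/2}(\Omega)$ such that for all $w\in\mathcal{W}$ the set $S_w$ of all saddle points of $F_w$ satisfies $S_w\subset B_1(0,r_1)\times B_2(0,r_2)$. If $F_w$ is additionally assumed to be strictly concave in $u$ and strictly convex in $v$, then the saddle point is unique.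
   Context: Standing assumptions: $n\ge 3$, $\Omega\subset\mathbb{R}^n$ is a bounded domain with Lipschitz boundary, $\alpha\in(1,2)$, $2^*_\alpha=\frac{2n}{n-\alpha}$. Let $(z_k,\rho_k)_{k\in\mathbb{N}}$ be the system of ($L^2(\Omega)$-orthonormal) eigenfunctions and eigenvalues of $-\Delta$ on $\Omega$ with homogeneous Dirichlet boundary condition; $\rho_1$ is the principal (smallest) eigenvalue. $H_0^{\alpha/2}(\Omega)$ is the space of functions $z=\sum_k a_kz_k$ with $\sum_k a_k^2\rho_k^{\alpha/2}<\infty$, with norm $\|z\|^2_{H_0^{\alpha/2}(\Omega)}=\sum_k a_k^2\rho_k^{\alpha/2}=\|(-\Delta)^{\alpha/4}z\|^2_{L^2(\Omega)}$, where the (spectral Dirichlet) fractional powers are $(-\Delta)^{\alpha/2}z=\sum_k a_k\rho_k^{\alpha/2}z_k$ and $(-\Delta)^{\alpha/4}z=\sum_k a_k\rho_k^{\alpha/4}z_k$. The space $\mathbb{H}_0^{\alpha/2}$ carries the norm $\|(u,v)\|^2=\|u\|^2_{H_0^{\alpha/2}(\Omega)}+\|v\|^2_{H_0^{\alpha/2}(\Omega)}$. A pair $(u_0,v_0)\in\mathbb{H}_0^{\alpha/2}$ is a saddle point of $F_w$ if $F_w(u,v_0)\le F_w(u_0,v_0)\le F_w(u_0,v)$ for all $u,v\in H_0^{\alpha/2}(\Omega)$. *)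

(* Defs.v *)
From HB Require Import structures.
From mathcomp Require Import all_boot all_order all_algebra.
From mathcomp Require Import all_classical all_reals all_analysis.

Set Implicit Arguments.
Unset Strict Implicit.
Unset Printing Implicit Defensive.

Import Order.TTheory GRing.Theory Num.Def Num.Theory.
Import numFieldNormedType.Exports.

Local Open Scope classical_set_scope.
Local Open Scope ring_scope.

(* The library norm of 'rV[R]_n is the sup norm: it provides the topology and
   the notion of bounded set, while [enorm] is the Euclidean norm. *)
Section euclidean.
Context {R : realType} {n : nat}.
Implicit Types x y : 'rV[R]_n.

Definition edot x y : R := \sum_i x 0 i * y 0 i.

Definition enorm x : R := Num.sqrt (edot x x).

End euclidean.

(* n-dimensional Lebesgue measure: the restriction of the outer measure below
   to its Caratheodory-measurable sets. *)
Section lebesgue.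
Context {R : realType} {n : nat}.
Implicit Types (a b : 'rV[R]_n) (A : set 'rV[R]_n).
Local Open Scope ereal_scope.

Definition box a b : set 'rV[R]_n :=
  [set x | forall i, (a 0%R i < x 0%R i <= b 0%R i)%R].

Definition box_vol a b : \bar R := (\prod_i Num.max 0 (b 0 i - a 0 i))%R%:E.

(* Covers are indexed by an arbitrary D : set nat rather than by nat because,
   for n = 0, no box is empty or has volume 0. *)
Definition lebesgue_outer A : \bar R :=
  ereal_inf [set t | exists (D : set nat) (a b : nat -> 'rV[R]_n),
    A `<=` \bigcup_(k in D) box (a k) (b k) /\
    t = \esum_(k in D) box_vol (a k) (b k)].

Lemma box_vol_ge0 a b : 0 <= box_vol a b.
Proof.
by rewrite lee_fin; apply: prodr_ge0 => i _; rewrite le_max lexx.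
Qed.

Lemma lebesgue_outer_ge0 A : 0 <= lebesgue_outer A.
Proof.
apply: le_ereal_inf_tmp => _ [D [a [b [_ ->]]]].
by apply: esum_ge0 => k _; exact: box_vol_ge0.
Qed.

Lemma lebesgue_outer0 : lebesgue_outer set0 = 0.
Proof.
apply/eqP; rewrite eq_le lebesgue_outer_ge0 andbT.
apply: ereal_inf_lbound; exists set0, (fun=> 0%R), (fun=> 0%R); split => //.
by rewrite esum_set0.
Qed.

Lemma le_lebesgue_outer : {homo lebesgue_outer : A B / A `<=` B >-> A <= B}.
Proof.
move=> A B AB; apply/ereal_inf_le_tmp => _ [D [a [b [BD ->]]]].
by exists D, a, b; split => //; exact: subset_trans BD.
Qed.

Lemma lebesgue_outer_sigma_subadditive : sigma_subadditive lebesgue_outer.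
Proof.
move=> A; have [[i ioo]|] := pselect (exists i, lebesgue_outer (A i) = +oo).
  rewrite (eseries_pinfty _ _ ioo) ?leey// => k _.
  by rewrite -ltNye (lt_le_trans _ (lebesgue_outer_ge0 _)).
rewrite -forallNE => Aoo.
suff add2e (e : {posnum R}) : lebesgue_outer (\bigcup_k A k) <=
    \sum_(i <oo) lebesgue_outer (A i) + e%:num%:E.
  by apply/lee_addgt0Pr => _/posnumP[].
rewrite (le_trans _ (epsilon_trick _ _ _))//; last first.
  by move=> k; exact: lebesgue_outer_ge0.
have /choice[G PG] : forall k, exists G : set nat * (nat -> 'rV[R]_n) * (nat -> 'rV[R]_n),
    A k `<=` \bigcup_(j in G.1.1) box (G.1.2 j) (G.2 j) /\
    \esum_(j in G.1.1) box_vol (G.1.2 j) (G.2 j) <=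
      lebesgue_outer (A k) + (e%:num / (2 ^ k.+1)%:R)%:E.
  move=> k.
  have fink : lebesgue_outer (A k) \is a fin_num.
    by rewrite ge0_fin_numE ?lebesgue_outer_ge0// ltey; exact/eqP/Aoo.
  have ek : (0 < e%:num / (2 ^ k.+1)%:R)%R by [].
  have [_ [D [a [b [AD ->]]]] lt_e] := lb_ereal_inf_adherent ek fink.
  by exists (D, a, b); split => //=; exact/ltW.
have vol0 k j : 0 <= box_vol ((G k).1.2 j) ((G k).2 j) by exact: box_vol_ge0.
have /card_esym/ppcard_eqP[f] := card_nat2.
apply: (@le_trans _ _
    (\esum_(i in [set: nat]) \esum_(j in (G i).1.1)
       box_vol ((G i).1.2 j) ((G i).2 j))); last first.
  rewrite -nneseries_esumT; last by move=> i; apply: esum_ge0.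
  apply: lee_nneseries => [i _ _|i _]; first exact: esum_ge0.
  by case: (PG i).
rewrite esum_esum//; apply: ereal_inf_lbound.
pose D := f @^-1` ([set: nat] `*`` fun i => (G i).1.1).
exists D, (fun k => (G (f k).1).1.2 (f k).2), (fun k => (G (f k).1).2 (f k).2).
split.
  move=> x [i _ /(proj1 (PG i)) [j Gij xij]].
  by exists (f^-1%FUN (i, j)); rewrite /D/= invK ?inE.
rewrite (reindex_esum D _ f)//; split => //.
- by move=> x y _ _ /(inj (f := f)) ->//; rewrite inE.
- by move=> [i j] ij; exists (f^-1%FUN (i, j)); rewrite /D/= invK ?inE.
Qed.

HB.instance Definition _ := isOuterMeasure.Build R 'rV[R]_n lebesgue_outer
  lebesgue_outer0 lebesgue_outer_ge0 le_lebesgue_outer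
  lebesgue_outer_sigma_subadditive.

End lebesgue.
Arguments lebesgue_outer {R} n A.

(* R^n with the sigma-algebra of Lebesgue-measurable sets; convertible to
   'rV[R]_n. *)
Notation Leb R n := (caratheodory_type (@lebesgue_outer R n)).

Definition leb (R : realType) (n : nat) : set (Leb R n) -> \bar R :=
  lebesgue_outer n.

HB.instance Definition _ (R : realType) (n : nat) :=
  isMeasure.Build _ _ _ (@leb R n)
    (@caratheodory_measure0 R 'rV[R]_n (lebesgue_outer n))
    (@caratheodory_measure_ge0 R 'rV[R]_n (lebesgue_outer n))
    (@caratheodory_measure_sigma_additive R 'rV[R]_n (lebesgue_outer n)).

Arguments leb {R} n A.

Section domain.
Context {R : realType} {n : nat}.
Implicit Types (Omega : set 'rV[R]_n).

Definition is_domain Omega := [/\ open Omega, connected Omega & Omega !=set0].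

(* Near every boundary point, in the direction of some unit vector e, Omega is
   the strict epigraph of a Lipschitz function h of the component orthogonal
   to e; only the values of h on the hyperplane orthogonal to e matter. *)
Definition lipschitz_boundary Omega :=
  forall x0, (closure Omega `\` interior Omega) x0 ->
  exists (r : R) (e : 'rV[R]_n) (h : 'rV[R]_n -> R) (L : R),
    [/\ 0 < r, enorm e = 1,
        forall y y', `|h y - h y'| <= L * enorm (y - y') &
        forall y, enorm (y - x0) < r ->
          Omega y <-> h (y - edot y e *: e) < edot y e].

Definition partial (i : 'I_n) (f : 'rV[R]_n -> R) : 'rV[R]_n -> R :=
  fun x => 'D_(delta_mx 0 i) f x.

Definition iter_partial (s : seq 'I_n) (f : 'rV[R]_n -> R) : 'rV[R]_n -> R :=
  foldr partial f s.

Definition smooth (f : 'rV[R]_n -> R) := forall s : seq 'I_n,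
  continuous (iter_partial s f) /\
  forall i x, derivable (iter_partial s f) x (delta_mx 0 i).

Definition test_function Omega (phi : 'rV[R]_n -> R) :=
  smooth phi /\ exists K : set 'rV[R]_n,
    [/\ compact K, K `<=` Omega & forall x, ~ K x -> phi x = 0].

End domain.

Section Lebesgue_spaces.
Context {R : realType} {n : nat}.
Variable Omega : set (Leb R n).
Implicit Types f g : Leb R n -> R.

Definition Lp (p : \bar R) : set (Leb R n -> R) :=
  [set f | f \_ Omega \in Lfun (leb n) p].

Definition Lp_vec (m : nat) (p : \bar R) : set (Leb R n -> 'rV[R]_m) :=
  [set w : Leb R n -> 'rV[R]_m |
    (forall i, measurable_fun Omega (fun x => w x 0 i)) /\
    Lp p (fun x => enorm (w x))].

Definition L2_dot f g : R := \int[leb n]_(x in Omega) (f x * g x).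

Definition L2_norm f : \bar R := ('N[leb n]_2%:E[EFin \o (f \_ Omega)])%E.

Definition L2_cvg (f_ : nat -> Leb R n -> R) f :=
  (fun j => L2_norm (fun x => f_ j x - f x)) @ \oo --> 0%E.

Definition L2_expansion (e : nat -> Leb R n -> R) (a : nat -> R) f :=
  Lp 2%:E f /\ L2_cvg (fun N x => \sum_(k < N) a k * e k x) f.

(* z lies in H^1_0(Omega), the H^1-closure of the test functions, and has weak
   gradient g. *)
Definition H10_gradient (z : Leb R n -> R) (g : 'I_n -> Leb R n -> R) :=
  [/\ Lp 2%:E z, forall i, Lp 2%:E (g i) &
      exists phi : nat -> 'rV[R]_n -> R,
        [/\ forall j, test_function Omega (phi j), L2_cvg phi z &
            forall i, L2_cvg (fun j => partial i (phi j)) (g i)]].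

(* Weak formulation of - Delta z = rho z in Omega, z = 0 on the boundary. *)
Definition dirichlet_eigenfunction (z : Leb R n -> R) (rho : R) :=
  ~ (z = cst 0 %[ae leb n in Omega]) /\
  exists g : 'I_n -> Leb R n -> R, H10_gradient z g /\
    forall phi, test_function Omega phi ->
      \sum_i L2_dot (g i) (partial i phi) = rho * L2_dot z phi.

(* Complete orthonormal system of L^2(Omega) made of Dirichlet eigenfunctions;
   the index 0 carries the smallest eigenvalue. *)
Definition dirichlet_eigensystem (z : nat -> Leb R n -> R) (rho : nat -> R) :=
  [/\ forall k, dirichlet_eigenfunction (z k) (rho k),
      forall j k, L2_dot (z j) (z k) = (j == k)%:R,
      forall f, Lp 2%:E f -> (forall k, L2_dot f (z k) = 0) ->
        f = cst 0 %[ae leb n in Omega] &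
      forall k, rho 0%N <= rho k].

Section fractional.
Variables (z : nat -> Leb R n -> R) (rho : nat -> R).

(* H_0^{alpha/2}(Omega), as a set of functions; two functions that agree a.e.
   on Omega represent the same element. *)
Definition frac_sobolev (alpha : R) : set (Leb R n -> R) :=
  [set f | exists a : nat -> R, L2_expansion z a f /\
    (\sum_(k <oo) (a k ^+ 2 * rho k `^ (alpha / 2))%:E < +oo)%E].

(* z is orthonormal, so the coefficients of f are the L2_dot f (z k). *)
Definition frac_sobolev_norm (alpha : R) f : R :=
  Num.sqrt (fine
    (\sum_(k <oo) (L2_dot f (z k) ^+ 2 * rho k `^ (alpha / 2))%:E)%E).

(* (- Delta)^s f, determined a.e. on Omega by its expansion. *)
Definition frac_lap (s : R) f : Leb R n -> R :=
  xget (cst 0) [set g | L2_expansion z (fun k => L2_dot f (z k) * rho k `^ s) g].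

Definition functional (alpha : R) (m : nat)
    (G : Leb R n -> R -> R -> 'rV[R]_m -> R) (w : Leb R n -> 'rV[R]_m)
    (u v : Leb R n -> R) : R :=
  \int[leb n]_(x in Omega)
    (2^-1 * `|frac_lap (alpha / 4) v x| ^+ 2
     - 2^-1 * `|frac_lap (alpha / 4) u x| ^+ 2
     + G x (u x) (v x) (w x)).

End fractional.

End Lebesgue_spaces.

Definition admissible (R : realType) (n m : nat) (Omega : set (Leb R n))
    (p : \bar R) (M : set 'rV[R]_m) : set (Leb R n -> 'rV[R]_m) :=
  [set w | Lp_vec Omega p w /\ \forall x \ae leb n, Omega x -> M (w x)].

Section partial_derivatives.
Context {R : realType} {X W : Type}.
Variable G : X -> R -> R -> W -> R.

Definition partial_u x u v w : R := 'D_1 (fun t : R => G x t v w) u.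

Definition partial_v x u v w : R := 'D_1 (fun t : R => G x u t w) v.

Definition has_partials (A : set X) := forall x u v w, A x ->
  derivable (fun t : R => G x t v w) u 1 /\
  derivable (fun t : R => G x u t w) v 1.

End partial_derivatives.

Definition caratheodory_fun (R : realType) (n m : nat) (Omega : set (Leb R n))
    (f : Leb R n -> R -> R -> 'rV[R]_m -> R) :=
  (forall u v w, measurable_fun Omega (fun x => f x u v w)) /\
  \forall x \ae leb n, Omega x ->
    continuous (fun q : R * R * 'rV[R]_m => f x q.1.1 q.1.2 q.2).

Definition saddle_point (R : realType) (T : Type) (H : set (T -> R))
    (F : (T -> R) -> (T -> R) -> R) (u0 v0 : T -> R) :=
  [/\ H u0, H v0 &
      forall u v, H u -> H v -> F u v0 <= F u0 v0 /\ F u0 v0 <= F u0 v].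

(* The points of E are identified up to eqv. *)
Definition strictly_convex (R : realType) (E : lmodType R)
    (eqv : E -> E -> Prop) (H : set E) (F : E -> R) :=
  forall (x y : E) (t : R), H x -> H y -> ~ eqv x y -> 0 < t < 1 ->
    F (t *: x + (1 - t) *: y) < t * F x + (1 - t) * F y.

Section concave_convex.
Context {R : realType} {T : Type}.
Implicit Types (H : set (T -> R^o)) (F : (T -> R^o) -> (T -> R^o) -> R^o).

Definition concave_convex H F :=
  (forall v, H v -> convex_function H (fun u => - F u v)) /\
  (forall u, H u -> convex_function H (F u)).

Definition strictly_concave_convex (eqv : (T -> R^o) -> (T -> R^o) -> Prop)
    H F :=
  (forall v, H v -> strictly_convex eqv H (fun u => - F u v)) /\
  (forall u, H u -> strictly_convex eqv H (F u)).

End concave_convex.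

(* Main.v *)
Require Import Defs.
From mathcomp Require Import all_boot all_order all_algebra.
From mathcomp Require Import all_classical all_reals all_analysis.
From mathcomp Require Import measurable_realfun ring lra.

(* Each functional F_w is handled on the spectral domain of (-Delta)^(alpha/4),
   a complete space for the graph norm, with functions identified a.e. (A3) and
   (A4) bound G(x, u(x), v(x), w(x)) from both sides by integrable functions,
   so no Sobolev embedding is needed for integrability; by Parseval's identity
   they also make F_w(u, .) and -F_w(., v) coercive, uniformly in w when u = 0
   and v = 0, and by Fatou's lemma strongly lower semicontinuous. Weak
   compactness is avoided as follows. A strongly convex-concave function has a
   saddle point, because minimizing sequences are Cauchy. The saddle points of
   the regularizations F_w + e (|v|^2 - |u|^2) are bounded, and monotonicity
   makes them converge strongly as e tends to 0. *)

Set Implicit Arguments.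
Unset Strict Implicit.
Unset Printing Implicit Defensive.

Import Order.TTheory GRing.Theory Num.Def Num.Theory.
Import numFieldNormedType.Exports.

Local Open Scope classical_set_scope.
Local Open Scope ring_scope.

(** * Saddle points on a complete Hilbert seminorm *)

(** The operator [frac_lap] picks representatives through [xget], so it is linear only up to null
    sets. The abstract part therefore asks of q only what survives this: homogeneity, the identity
    on segments, and existence of limits of Cauchy sequences. The graph norm is complete because a
    diagonal operator is closed: L^2 limits of f_k and L f_k have coefficients related by the same
    multipliers. Coercivity in this norm comes from the strict inequality 2 b < rho_1^(alpha/2),
    which leaves room in 1/2 |L v|^2 - b |v|^2 for a small multiple of |v|^2 + |L v|^2. The ball
    containing the saddle points is uniform in w because F_w(0, v) <= F_w(u, v) <= F_w(u, 0) at a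
    saddle point, and the data of (A3) at u = 0 and of (A4) at v = 0 do not depend on w. *)

Lemma eventually_invS_lt (R : realType) (d : R) : 0 < d ->
  exists N : nat, forall k, (N <= k)%N -> k.+1%:R^-1 < d.
Proof.
move=> d0; exists (Num.truncn d^-1) => k Nk; rewrite invf_plt ?posrE//.
by rewrite (lt_le_trans (truncnS_gt _))// ler_nat.
Qed.

Section saddle.
Context {R : realType} {V : lmodType R}.
Implicit Types (H : set V) (q phi : V -> R) (u v x y : V) (e t : R).

Definition quad_cvg q (x_ : nat -> V) x :=
  forall e, 0 < e -> exists N, forall k, (N <= k)%N -> q (x_ k - x) < e.

Definition quad_cauchy q (x_ : nat -> V) :=
  forall e, 0 < e ->
    exists N, forall j k, (N <= j)%N -> (N <= k)%N -> q (x_ j - x_ k) < e.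

(* The fourth condition is the parallelogram identity in the form that gives the
   modulus of convexity: q is the square of a complete Hilbert seminorm on H. *)
Definition hilbert_quad H q := [/\ H 0,
    (forall t x y, H x -> H y -> H (t *: x + y)),
    (forall x, H x -> 0 <= q x) /\
      (forall t x, H x -> q (t *: x) = t ^+ 2 * q x),
    (forall t x y, H x -> H y ->
      q (t *: x + (1 - t) *: y) =
        t * q x + (1 - t) * q y - t * (1 - t) * q (x - y)) &
    forall x_ : nat -> V, (forall k, H (x_ k)) -> quad_cauchy q x_ ->
      exists2 x, H x & quad_cvg q x_ x].

(** When q satisfies [hilbert_quad], this is convexity of phi - e q on H; e = 0 is plain
    convexity. *)
Definition convex_mod H q e phi := forall t x y, H x -> H y -> 0 <= t <= 1 ->
  phi (t *: x + (1 - t) *: y) <=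
    t * phi x + (1 - t) * phi y - e * (t * (1 - t) * q (x - y)).

Definition lower_semicts H q phi := forall x, H x -> forall e, 0 < e ->
  exists2 d, 0 < d & forall y, H y -> q (y - x) < d -> phi x - e < phi y.

Lemma le_of_scaled_lt1 (e a b : R) : 0 <= e ->
  (forall t, 0 < t < 1 -> (1 - t) * (e * a) <= b) -> e * a <= b.
Proof.
move=> e0 h; rewrite leNgt; apply/negP => lt.
have b0 : 0 <= b \/ b < 0 by case: (leP 0 b); [left|right].
have := h 2^-1; rewrite invr_gt0 invf_lt1 ?ltr1n// ltr0n/= => /(_ isT) h2.
case: b0 => b0; last by lra.
have ea0 : 0 < e * a by lra.
have D0 : 0 < 2 * (e * a) by lra.
(* This t makes (1 - t) * (e * a) the midpoint of b and e * a, which exceeds b. *)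
have /h : 0 < (e * a - b) / (2 * (e * a)) < 1.
  by apply/andP; split; [rewrite divr_gt0//; lra|rewrite ltr_pdivrMr//; lra].
suff -> : (1 - (e * a - b) / (2 * (e * a))) * (e * a) = (e * a + b) / 2.
  by move=> h3; lra.
by field; move: ea0; have [->|a0] := eqVneq a 0; rewrite ?mulr0 ?ltxx// => ea0;
  apply/andP; split => //; apply: contraTneq ea0 => ->; rewrite mul0r ltxx.
Qed.

Section quad.
Variables (H : set V) (q : V -> R).
Hypothesis Hq : hilbert_quad H q.

Let H0 : H 0. Proof. by case: Hq. Qed.

Let q_ge0 x : H x -> 0 <= q x. Proof. by case: Hq => _ _ [+ _] _ _; apply. Qed.

Lemma quad_mem_scale t x : H x -> H (t *: x).
Proof. by move=> Hx; rewrite -[_ *: _]addr0; case: Hq => _ + _ _ _; apply. Qed.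

Lemma quad_mem_add x y : H x -> H y -> H (x + y).
Proof. by move=> Hx Hy; rewrite -[x]scale1r; case: Hq => _ + _ _ _; apply. Qed.

Lemma quad_mem_sub x y : H x -> H y -> H (x - y).
Proof.
by move=> Hx Hy; apply: quad_mem_add => //; rewrite -scaleN1r; exact: quad_mem_scale.
Qed.

Lemma quad_mem_conv t x y : H x -> H y -> H (t *: x + (1 - t) *: y).
Proof. by move=> Hx Hy; apply: quad_mem_add; exact: quad_mem_scale. Qed.

#[local] Hint Extern 0 (H _) => solve [repeat (first [assumption |
  apply: quad_mem_conv | apply: quad_mem_sub | apply: quad_mem_add |
  apply: quad_mem_scale])] : core.

Lemma quad_subC x y : H x -> H y -> q (x - y) = q (y - x).
Proof.
move=> Hx Hy; case: Hq => _ _ [_ qZ] _ _.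
by rewrite -(opprB y) -(scaleN1r (y - x)) qZ// sqrrN expr1n mul1r.
Qed.

(** Convexity of q applied to x = t (y / t) + (1 - t) ((x - y) / (1 - t)), then multiplied by t.
    This plays the role of the triangle inequality for the square q. *)
Lemma quad_le_segment x y t : H x -> H y -> 0 < t < 1 ->
  t * q x <= q y + t / (1 - t) * q (x - y).
Proof.
move=> Hx Hy /andP[t0 t1]; case: Hq => _ _ [_ qZ] qc _.
have t1' : 1 - t != 0 by lra.
have := @qc t (t^-1 *: y) ((1 - t)^-1 *: (x - y)) ltac:(done) ltac:(done).
rewrite !scalerA (divff t1') (divff (lt0r_neq0 t0)) !scale1r addrC subrK.
rewrite !qZ// => qx.
have le0 : 0 <= q (t^-1 *: y - (1 - t)^-1 *: (x - y)) by rewrite q_ge0.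
have qxy : q x <= q y / t + q (x - y) / (1 - t).
  have -> : q y / t + q (x - y) / (1 - t) =
    t * (t^-1 ^+ 2 * q y) + (1 - t) * ((1 - t)^-1 ^+ 2 * q (x - y)).
    by field; rewrite t1' lt0r_neq0.
  by rewrite qx gerBl mulr_ge0// mulr_ge0; lra.
have -> : q y + t / (1 - t) * q (x - y) = t * (q y / t + q (x - y) / (1 - t)).
  by field; rewrite t1' lt0r_neq0.
by rewrite ler_pM2l.
Qed.

Lemma quad_lower_semicts : lower_semicts H q q.
Proof.
move=> x Hx e e0; have qx := q_ge0 Hx.
have D0 : 0 < 2 * (q x + e) by lra.
(* With t = 1 - s, [quad_le_segment] loses s * q x < e / 2 on the left and, within the radius s * e
   / 2, adds at most e / 2 on the right. *)
pose s := e / (2 * (q x + e)).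
have s0 : 0 < s by rewrite divr_gt0.
have s1 : s <= 1 / 2 by rewrite ler_pdivrMr//; lra.
have sD : s * (q x + e) = e / 2 by rewrite /s; field; lra.
have se : 0 < s * e by rewrite mulr_gt0.
exists (s * e / 2) => [|y Hy yx]; first by lra.
have := @quad_le_segment x y (1 - s) Hx Hy; rewrite (quad_subC Hx Hy).
have -> : 1 - (1 - s) = s by ring.
move=> /(_ ltac:(lra)) le1.
have : (1 - s) / s * q (y - x) <= e / 2.
  have -> : e / 2 = s^-1 * (s * e / 2) by field; lra.
  have -> : (1 - s) / s * q (y - x) = s^-1 * ((1 - s) * q (y - x)) by ring.
  rewrite ler_pM2l ?invr_gt0//.
  have := q_ge0 (quad_mem_sub Hy Hx); nra.
lra.
Qed.

Lemma lower_semicts_le phi (x_ : nat -> V) x c : lower_semicts H q phi ->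
  (forall k, H (x_ k)) -> H x -> quad_cvg q x_ x ->
  (forall e, 0 < e -> exists N, forall k, (N <= k)%N -> phi (x_ k) < c + e) ->
  phi x <= c.
Proof.
move=> lphi Hx_ Hx xx h; apply/ler_addgt0Pr => e e0.
have e2 : 0 < e / 2 by lra.
have [d d0 hd] := lphi x Hx _ e2.
have [N hN] := xx d d0; have [N' hN'] := h _ e2.
have := hd _ (Hx_ (maxn N N')) (hN _ (leq_maxl _ _)).
have := hN' _ (leq_maxr N N'); lra.
Qed.

Lemma lower_semictsD phi psi : lower_semicts H q phi ->
  lower_semicts H q psi -> lower_semicts H q (fun x => phi x + psi x).
Proof.
move=> h1 h2 x Hx e e0; have e2 : 0 < e / 2 by lra.
have [d1 d10 {}h1] := h1 x Hx _ e2; have [d2 d20 {}h2] := h2 x Hx _ e2.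
exists (Num.min d1 d2) => [|y Hy]; first by rewrite lt_min d10.
rewrite lt_min => /andP[/(h1 _ Hy) + /(h2 _ Hy)]; lra.
Qed.

Lemma eq_lower_semicts phi psi : (forall x, H x -> phi x = psi x) ->
  lower_semicts H q phi -> lower_semicts H q psi.
Proof.
move=> e h x Hx r r0; have [d d0 {}h] := h x Hx r r0.
by exists d => // y Hy /(h _ Hy); rewrite !e.
Qed.

Lemma lower_semictsZ phi c : 0 < c -> lower_semicts H q phi ->
  lower_semicts H q (fun x => c * phi x).
Proof.
move=> c0 h x Hx e e0; have ec : 0 < e / c by rewrite divr_gt0.
have [d d0 {}h] := h x Hx _ ec; exists d => // y Hy /(h _ Hy).
by rewrite -(ltr_pM2l c0) mulrBr mulrCA divff ?mulr1// gt_eqF.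
Qed.

Lemma lower_semicts_cst c : lower_semicts H q (fun=> c).
Proof. by move=> x _ e e0; exists 1 => // y _ _; lra. Qed.

(** A converse of [lower_semicts_le], in the form that Fatou's lemma provides: a failure at x yields
    points y_k with q (y_k - x) < 1 / (k + 1) in the sublevel set of phi x - e. *)
Lemma cvg_lower_semicts phi :
  (forall (x_ : nat -> V) x c, (forall k, H (x_ k)) -> H x -> quad_cvg q x_ x ->
     (forall k, phi (x_ k) <= c) -> phi x <= c) -> lower_semicts H q phi.
Proof.
move=> h x Hx e e0; apply: contrapT => nd.
have /choice[x_ hx_] : forall k : nat, exists y,
    [/\ H y, q (y - x) < k.+1%:R^-1 & phi y <= phi x - e].
  move=> k; apply: contrapT => ny; apply: nd; exists k.+1%:R^-1 => // y Hy yx.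
  by rewrite ltNge; apply/negP => ?; apply: ny; exists y.
have := h x_ x (phi x - e); suff: quad_cvg q x_ x.
  by move=> xx /(_ (fun k => let: And3 H1 _ _ := hx_ k in H1) Hx xx
    (fun k => let: And3 _ _ H1 := hx_ k in H1)); lra.
move=> d /eventually_invS_lt[N hN]; exists N => k /hN kd.
by case: (hx_ k) => _ /lt_trans + _; exact.
Qed.

Lemma convex_modD e phi e' psi : convex_mod H q e phi ->
  convex_mod H q e' psi -> convex_mod H q (e + e') (fun x => phi x + psi x).
Proof.
move=> h1 h2 t x y Hx Hy t01.
by have := h1 t x y Hx Hy t01; have := h2 t x y Hx Hy t01; lra.
Qed.

Lemma convex_mod_cst c : convex_mod H q 0 (fun=> c).
Proof. by move=> t x y _ _ _; rewrite mul0r subr0 -mulrDl addrC subrK mul1r. Qed.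

Lemma convex_mod_quad c : convex_mod H q c (fun x => c * q x).
Proof.
move=> t x y Hx Hy t01; case: Hq => _ _ _ qc _; rewrite qc//.
by rewrite le_eqVlt; apply/orP; left; apply/eqP; ring.
Qed.

(** Compare x with t y + (1 - t) x, divide by t and let t tend to 0. *)
Lemma convex_mod_growth e phi x : 0 <= e -> convex_mod H q e phi -> H x ->
  (forall y, H y -> phi x <= phi y) ->
  forall y, H y -> phi x + e * q (y - x) <= phi y.
Proof.
move=> e0 cphi Hx xmin y Hy.
suff : e * q (y - x) <= phi y - phi x by lra.
apply: le_of_scaled_lt1 => // t t01.
have := cphi t _ _ Hy Hx ltac:(lra); have := xmin _ (quad_mem_conv t Hy Hx).
have [t0 t1] := andP t01.
move=> h1 h2; have : t * ((1 - t) * (e * q (y - x))) <= t * (phi y - phi x) by lra.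
by rewrite ler_pM2l.
Qed.

(* A minimizing sequence is Cauchy by the modulus of convexity at midpoints. *)
Lemma strong_convex_min e phi c : 0 < e -> convex_mod H q e phi ->
  lower_semicts H q phi -> (forall x, H x -> c <= phi x) ->
  exists2 x, H x & forall y, H y -> phi x + e * q (y - x) <= phi y.
Proof.
move=> e0 cphi lphi cle.
pose S := [set phi x | x in H].
have infS : has_inf S.
  split; first by exists (phi 0), 0.
  by exists c => _ [x Hx <-]; exact: cle.
pose m := inf S.
have mle x : H x -> m <= phi x by move=> Hx; apply: ge_inf; [case: infS|exists x].
have /choice[x_ hx_] : forall k : nat, exists x, H x /\ phi x < m + k.+1%:R^-1.
  move=> k; have [|_ [x Hx <-] h] := @inf_adherent _ S k.+1%:R^-1 _ infS => //.
  by exists x.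
have Hx_ k : H (x_ k) by case: (hx_ k).
have [x Hx xx] : exists2 x, H x & quad_cvg q x_ x.
  case: Hq => _ _ _ _; apply => // d d0.
  (* At t = 1/2 the modulus is e / 4 times q (x_j - x_k), and it is at most the mean of the excesses
     of phi (x_j) and phi (x_k) over the infimum m. *)
  have ed : 0 < e * d / 4 by rewrite divr_gt0// mulr_gt0.
  have [N hN] := eventually_invS_lt ed.
  exists N => j k /hN jN /hN kN.
  have := cphi 2^-1 _ _ (Hx_ j) (Hx_ k) ltac:(lra).
  have := mle _ (quad_mem_conv 2^-1 (Hx_ j) (Hx_ k)).
  have := (hx_ j).2; have := (hx_ k).2 => h1 h2 h3 h4.
  rewrite -(ltr_pM2l e0).
  have half : 1 - 2^-1 = 2^-1 :> R by field.
  have quart : e * (2^-1 * 2^-1 * q (x_ j - x_ k)) = e * q (x_ j - x_ k) / 4.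
    by field.
  move: h1 h2 h3 h4 jN kN; rewrite half quart.
  by move: (j.+1%:R^-1) (k.+1%:R^-1) => a b; clearbody m; lra.
exists x => //; apply: convex_mod_growth => //; first exact: ltW.
move=> y Hy; apply: le_trans (mle _ Hy).
apply: (lower_semicts_le lphi Hx_ Hx xx) => d /eventually_invS_lt[N hN].
exists N => k /hN; have := (hx_ k).2; move: (k.+1%:R^-1) => a; lra.
Qed.

(* If u0 maximizes phi u := min K u and v0 minimizes K u0, then comparing u0 with
   t u + (1 - t) u0 as t tends to 0 yields K u v0 <= K u0 v0. *)
Lemma strong_saddle e (K : V -> V -> R) : 0 < e ->
  (forall u, H u -> [/\ convex_mod H q e (K u), lower_semicts H q (K u) &
    exists c, forall v, H v -> c <= K u v]) ->
  (forall v, H v -> [/\ convex_mod H q e (fun u => - K u v),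
    lower_semicts H q (fun u => - K u v) &
    exists c, forall u, H u -> c <= - K u v]) ->
  exists u0 v0, [/\ H u0, H v0 &
    forall u v, H u -> H v -> K u v0 + e * q (u - u0) <= K u0 v0 /\
                              K u0 v0 + e * q (v - v0) <= K u0 v].
Proof.
move=> e0 Kv Ku.
have /choice[w hw] : forall u, exists v, H u ->
    H v /\ forall y, H y -> K u v + e * q (y - v) <= K u y.
  move=> u; have [Hu|nHu] := pselect (H u); last by exists 0 => /nHu.
  have [cK lK [c cle]] := Kv _ Hu.
  by have [v Hv hv] := strong_convex_min e0 cK lK cle; exists v.
pose phi u := K u (w u).
have Hw u : H u -> H (w u) by case/hw.
have wmin u v : H u -> H v -> phi u <= K u v.
  move=> Hu Hv; have [Hwu /(_ _ Hv)] := hw _ Hu; rewrite /phi.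
  have := q_ge0 (quad_mem_sub Hv Hwu); nra.
(* As a supremum of the functions - K u v over v, - phi inherits their modulus and their lower
   semicontinuity; it suffices to evaluate at the v that is optimal for the point considered. *)
have phi_convex : convex_mod H q e (fun u => - phi u).
  move=> t x y Hx Hy t01; set z := t *: x + (1 - t) *: y.
  have Hz : H z by [].
  have [cK _ _] := Ku _ (Hw _ Hz).
  have := cK t _ _ Hx Hy t01; rewrite -/z.
  have := wmin _ _ Hx (Hw _ Hz); have := wmin _ _ Hy (Hw _ Hz); rewrite /phi.
  have [t0 t1] := andP t01; nra.
have phi_lsc : lower_semicts H q (fun u => - phi u).
  move=> x Hx d d0; have [_ lK _] := Ku _ (Hw _ Hx).
  have [r r0 hr] := lK _ Hx _ d0; exists r => // y Hy yx.
  have := hr _ Hy yx; have := wmin _ _ Hy (Hw _ Hx); rewrite /phi; lra.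
have [c hc] : exists c, forall u, H u -> c <= - phi u.
  have [_ _ [c hc]] := Ku _ H0; exists c => u Hu.
  by have := hc _ Hu; have := wmin _ _ Hu H0; lra.
have [u0 Hu0 umax] := strong_convex_min e0 phi_convex phi_lsc hc.
have Hv0 := Hw _ Hu0.
have [_ vmin] := hw _ Hu0.
suff below u : H u -> K u (w u0) <= phi u0.
  exists u0, (w u0); split => // u v Hu Hv; split; last exact: vmin.
  have [cK _ _] := Ku _ Hv0.
  have lmin y : H y -> - K u0 (w u0) <= - K y (w u0).
    by move=> /below; rewrite lerN2.
  by have := convex_mod_growth (ltW e0) cK Hu0 lmin Hu; lra.
move=> Hu; apply/ler_addgt0Pr => d d0.
have [_ lK _] := Kv _ Hu; have [r r0 hr] := lK _ Hv0 _ d0.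
have D0 : 0 <= phi u0 - phi u.
  have := umax _ Hu; have := q_ge0 (quad_mem_sub Hu Hu0); nra.
have er : 0 < e * r by rewrite mulr_gt0.
(* This makes t * (phi u0 - phi u) < e * r / 2 and t <= 1 / 2. Then [h5] forces q (w z - w u0) < r,
   so lower semicontinuity of K u at w u0 applies to w z, where [h6] bounds K u by phi u0. *)
pose t := e * r / (2 * (phi u0 - phi u + e * r)).
have t0 : 0 < t by rewrite divr_gt0// mulr_gt0; lra.
have t1 : t <= 1 / 2 by rewrite ler_pdivrMr//; lra.
have tD : t * (phi u0 - phi u + e * r) = e * r / 2 by rewrite /t; field; lra.
pose z := t *: u + (1 - t) *: u0.
have Hz : H z by [].
have Hwz := Hw _ Hz.
have h1 : phi z <= phi u0.
  have := umax _ Hz; have := q_ge0 (quad_mem_sub Hz Hu0); nra.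
have h2 : t * K u (w z) + (1 - t) * K u0 (w z) <= phi z.
  have [cK _ _] := Ku _ Hwz; have := cK t _ _ Hu Hu0 ltac:(lra).
  have := q_ge0 (quad_mem_sub Hu Hu0); rewrite -/z /phi => quu.
  have : 0 <= e * (t * (1 - t) * q (u - u0)).
    by apply: mulr_ge0; [exact: ltW|apply: mulr_ge0 => //; apply: mulr_ge0; lra].
  lra.
have h3 := vmin _ Hwz; have h4 := wmin _ _ Hu Hwz.
have qwz := q_ge0 (quad_mem_sub Hwz Hv0).
have h5 : (1 - t) * (e * q (w z - w u0)) <= t * (phi u0 - K u (w z)).
  have : (1 - t) * (phi u0 + e * q (w z - w u0)) <= (1 - t) * K u0 (w z).
    by rewrite ler_pM2l//; lra.
  lra.
have h6 : K u (w z) <= phi u0.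
  have : 0 <= t * (phi u0 - K u (w z)).
    by apply: le_trans h5; apply: mulr_ge0; [lra|apply: mulr_ge0 => //; exact: ltW].
  by rewrite pmulr_rge0// subr_ge0.
have : q (w z - w u0) < r.
  rewrite -(ltr_pM2l e0).
  have : t * (phi u0 - K u (w z)) <= t * (phi u0 - phi u) by rewrite ler_pM2l//; lra.
  have : 0 < t * (e * r) by rewrite mulr_gt0.
  have : 1 / 2 * (e * q (w z - w u0)) <= (1 - t) * (e * q (w z - w u0)).
    by rewrite ler_wpM2r//; [rewrite mulr_ge0// ltW|lra].
  lra.
by move=> /(hr _ Hwz); lra.
Qed.

(* Tikhonov regularization: the saddle points of F + e (q v - q u) are bounded,
   and as e decreases to 0 the sum of their squared norms increases by at least
   the squared distance travelled, so that they form a Cauchy sequence. *)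
Theorem convex_saddle (F : V -> V -> R) (c C : R) : 0 < c ->
  (forall u, H u -> [/\ convex_mod H q 0 (F u), lower_semicts H q (F u) &
    exists d, forall v, H v -> d <= F u v]) ->
  (forall v, H v -> [/\ convex_mod H q 0 (fun u => - F u v),
    lower_semicts H q (fun u => - F u v) &
    exists d, forall u, H u -> d <= - F u v]) ->
  (forall v, H v -> c * q v - C <= F 0 v) ->
  (forall u, H u -> F u 0 <= C - c * q u) ->
  exists u0 v0, [/\ H u0, H v0 &
    forall u v, H u -> H v -> F u v0 <= F u0 v].
Proof.
move=> c0 Fv Fu Fge Fle.
pose eps (k : nat) : R := k.+1%:R^-1.
have eps0 k : 0 < eps k by rewrite invr_gt0.
have q00 : q 0 = 0.
  by case: Hq => _ _ [_ qZ] _ _; rewrite -(scale0r 0) qZ// expr0n mul0r.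
(* The two saddle inequalities, with their quadratic gains, are chained through the value at the
   saddle point, which disappears. *)
have /choice[x_ hx_] : forall k, exists x : V * V, [/\ H x.1, H x.2 &
    forall u v, H u -> H v ->
      F u x.2 + eps k * q x.2 - eps k * q u + eps k * q (u - x.1) <=
      F x.1 v + eps k * q v - eps k * q x.1 - eps k * q (v - x.2)].
  move=> k; have [||u [v [Hu Hv uv]]] := @strong_saddle (eps k)
    (fun u v => (F u v + eps k * q v) + - (eps k * q u)) (eps0 k).
  - move=> u Hu; have [cF lF [d hd]] := Fv _ Hu; split.
    + rewrite -[X in convex_mod _ _ X](addr0 (eps k)).
      apply: convex_modD (convex_mod_cst _).
      rewrite -[X in convex_mod _ _ X]add0r.
      by apply: convex_modD => //; exact: convex_mod_quad.
    + apply: lower_semictsD; last exact: lower_semicts_cst.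
      apply: lower_semictsD => //; apply: lower_semictsZ => //.
      exact: quad_lower_semicts.
    + exists (d - eps k * q u) => v Hv; have := hd _ Hv.
      have : 0 <= eps k * q v by rewrite mulr_ge0 ?q_ge0 ?ltW//.
      lra.
  - move=> v Hv; have [cF lF [d hd]] := Fu _ Hv.
    have -> : (fun u => - ((F u v + eps k * q v) + - (eps k * q u))) =
              (fun u => (- F u v + eps k * q u) + - (eps k * q v)).
      by apply/funext => u; ring.
    split.
    + rewrite -[X in convex_mod _ _ X](addr0 (eps k)).
      apply: convex_modD (convex_mod_cst _).
      rewrite -[X in convex_mod _ _ X]add0r.
      by apply: convex_modD => //; exact: convex_mod_quad.
    + apply: lower_semictsD; last exact: lower_semicts_cst.
      apply: lower_semictsD => //; apply: lower_semictsZ => //.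
      exact: quad_lower_semicts.
    + exists (d - eps k * q v) => u Hu; have := hd _ Hu.
      have : 0 <= eps k * q u by rewrite mulr_ge0 ?q_ge0 ?ltW//.
      lra.
  by exists (u, v); split => // u' v' Hu' Hv'; have [/=] := uv _ _ Hu' Hv'; lra.
have H1 k : H (x_ k).1 by case: (hx_ k).
have H2 k : H (x_ k).2 by case: (hx_ k).
pose n k := q (x_ k).1 + q (x_ k).2.
pose d j k := q ((x_ j).1 - (x_ k).1) + q ((x_ j).2 - (x_ k).2).
have dC j k : d j k = d k j.
  by rewrite /d (quad_subC (H1 j) (H1 k)) (quad_subC (H2 j) (H2 k)).
have d0 j k : 0 <= d j k by apply: addr_ge0; apply: q_ge0; apply: quad_mem_sub.
(* Testing with (0, 0) puts c * q x.2 - C below C - c * q x.1. *)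
have n_bnd k : n k <= 2 * C / c.
  case: (hx_ k) => _ _ /(_ _ _ H0 H0); have := Fge _ (H2 k); have := Fle _ (H1 k).
  rewrite ler_pdivlMr// q00 !mulr0 (quad_subC H0 (H1 k)) (quad_subC H0 (H2 k)) !subr0.
  have q1 : 0 <= eps k * q (x_ k).1 by rewrite mulr_ge0 ?q_ge0 ?ltW//.
  have q2 : 0 <= eps k * q (x_ k).2 by rewrite mulr_ge0 ?q_ge0 ?ltW//.
  rewrite /n; lra.
(* Test the inequality of x_j at x_k and that of x_k at x_j, and add: the values of F cancel. *)
have d_eps j k : (eps j + eps k) * d j k <= (eps j - eps k) * (n k - n j).
  case: (hx_ j) => _ _ /(_ _ _ (H1 k) (H2 k)).
  case: (hx_ k) => _ _ /(_ _ _ (H1 j) (H2 j)).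
  rewrite /d /n (quad_subC (H1 k) (H1 j)) (quad_subC (H2 k) (H2 j)); lra.
have d_le j k : (j <= k)%N -> d j k <= n k - n j.
  rewrite leq_eqVlt => /predU1P[->|jk].
    have := d_eps k k; rewrite !subrr mulr0 pmulr_rle0//; first exact: addr_gt0.
  have ejk : eps k < eps j by rewrite ltf_pV2 ?posrE// ltr_nat ltnS.
  (* The left side of [d_eps] is nonnegative and eps j > eps k, so n increases; eps j - eps k <= eps
     j + eps k then allows the factors to be dropped. *)
  have njk : 0 <= n k - n j.
    rewrite -(@pmulr_rge0 _ (eps j - eps k)) ?subr_gt0//; apply: le_trans (d_eps j k).
    by rewrite mulr_ge0// addr_ge0// ltW.
  have ejk0 : 0 < eps j + eps k by rewrite addr_gt0.
  rewrite -(ler_pM2l ejk0); apply: (le_trans (d_eps j k)); apply: ler_wpM2r => //.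
  by have := eps0 k; lra.
have supn : has_sup (range n).
  by split; [exists (n 0%N), 0%N|exists (2 * C / c) => _ [k _ <-]].
have cauchy r : 0 < r ->
    exists N, forall j k, (N <= j)%N -> (N <= k)%N -> d j k < r.
  move=> r0; have [_ [N _ <-] hN] := sup_adherent r0 supn.
  have nsup k : n k <= sup (range n) by apply: ub_le_sup; [case: supn|exists k].
  have nN k : (N <= k)%N -> n N <= n k by move=> /d_le; have := d0 N k; lra.
  exists N => j k Nj Nk; have := nsup j; have := nsup k; have := nN _ Nj; have := nN _ Nk.
  have [/d_le|/ltnW/d_le] := leqP j k; first lra.
  rewrite dC; lra.
have [_ _ _ _ complete] := Hq.
have [|u0 Hu0 uu0] := complete (fun k => (x_ k).1) H1.
  move=> r /cauchy[N hN]; exists N => j k Nj Nk; apply: le_lt_trans (hN _ _ Nj Nk).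
  by rewrite lerDl; apply: q_ge0; apply: quad_mem_sub.
have [|v0 Hv0 vv0] := complete (fun k => (x_ k).2) H2.
  move=> r /cauchy[N hN]; exists N => j k Nj Nk; apply: le_lt_trans (hN _ _ Nj Nk).
  by rewrite lerDr; apply: q_ge0; apply: quad_mem_sub.
exists u0, v0; split => // u v Hu Hv; apply/ler_addgt0Pr => r r0.
(* Three errors below r / 4: semicontinuity of F u at v0, of - F . v at u0, and the regularization,
   at most eps N * (q u + q v). *)
have r4 : 0 < r / 4 by lra.
have [_ /(_ _ Hv0 _ r4)[e1 e10 he1] _] := Fv _ Hu.
have [_ /(_ _ Hu0 _ r4)[e2 e20 he2] _] := Fu _ Hv.
have D0 : 0 < q u + q v + 1 by have := q_ge0 Hu; have := q_ge0 Hv; lra.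
have [N1 hN1] := vv0 _ e10; have [N2 hN2] := uu0 _ e20.
have [N3 hN3] := eventually_invS_lt (divr_gt0 r4 D0).
pose N := maxn N1 (maxn N2 N3).
have N1N : (N1 <= N)%N by rewrite leq_maxl.
have N2N : (N2 <= N)%N by rewrite leq_max leq_maxl orbT.
have N3N : (N3 <= N)%N by rewrite leq_max leq_maxr !orbT.
have := he1 _ (H2 N) (hN1 _ N1N); have := he2 _ (H1 N) (hN2 _ N2N).
have := hN3 _ N3N; rewrite ltr_pdivlMr// -/(eps N).
case: (hx_ N) => _ _ /(_ _ _ Hu Hv).
have e0 := eps0 N.
have g1 : 0 <= eps N * q (x_ N).2 by rewrite mulr_ge0 ?q_ge0 ?ltW//.
have g2 : 0 <= eps N * q (x_ N).1 by rewrite mulr_ge0 ?q_ge0 ?ltW//.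
have g3 : 0 <= eps N * q (u - (x_ N).1).
  by rewrite mulr_ge0 ?q_ge0 ?ltW//; exact: quad_mem_sub.
have g4 : 0 <= eps N * q (v - (x_ N).2).
  by rewrite mulr_ge0 ?q_ge0 ?ltW//; exact: quad_mem_sub.
lra.
Qed.

End quad.
End saddle.

(** * Lebesgue-measurable sets of R^n *)

Section lebesgue_measurable_sets.
Context {R : realType} {n : nat}.
Implicit Types (a b : 'rV[R]_n) (i : 'I_n) (c : R).

Let upd a i c : 'rV[R]_n := \row_j if j == i then c else a 0 j.

(** If c lies outside the i-th side, one piece has a reversed or degenerate side, to which [box_vol]
    gives the factor 0. *)
Let box_cut a b i c :
  (box_vol a (upd b i (Num.min (b 0 i) c))%R +
   box_vol (upd a i (Num.max (a 0 i) c))%R b)%E = box_vol a b.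
Proof.
rewrite /box_vol -EFinD; congr EFin.
rewrite (bigD1 i)//= [X in _ + X](bigD1 i)//= [RHS](bigD1 i)//= !mxE eqxx.
under eq_bigr => j /negbTE ji do rewrite mxE ji.
under [X in _ + _ * X]eq_bigr => j /negbTE ji do rewrite mxE ji.
rewrite -mulrDl; congr (_ * _).
case: (leP (b 0 i) c) => h1; case: (leP (a 0 i) c) => h2;
  by repeat case: leP => ?; lra.
Qed.

(* Cutting the boxes of a cover along a hyperplane preserves their total volume. *)
Lemma measurable_halfspace i c :
  measurable ([set x : Leb R n | x 0 i <= c] : set (Leb R n)).
Proof.
apply: le_caratheodory_measurable => X.
apply: le_ereal_inf_tmp => _ [D [a [b [XD ->]]]].
pose b' k := upd (b k) i (Num.min (b k 0 i) c).
pose a' k := upd (a k) i (Num.max (a k 0 i) c).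
have -> : (\esum_(k in D) box_vol (a k) (b k) =
  \esum_(k in D) box_vol (a k) (b' k) + \esum_(k in D) box_vol (a' k) (b k))%E.
  rewrite -esumD; try by move=> *; exact: box_vol_ge0.
  by apply: eq_esum => k _; rewrite -(box_cut (a k) (b k) i c).
apply: leeD; apply: ereal_inf_lbound.
  exists D, a, b'; split => // x [/XD[k Dk xk] xc]; exists k => // j.
  rewrite /b' mxE; case: eqP => [->|_]; last exact: xk.
  by have /andP[-> xb] := xk i; rewrite le_min xb.
exists D, a', b; split => // x [/XD[k Dk xk] xc]; exists k => // j.
rewrite /a' mxE; case: eqP => [->|_]; last exact: xk.
by have /andP[ax ->] := xk i; rewrite gt_max ax andbT ltNge; apply/negP.
Qed.

Lemma measurable_coord i : measurable_fun setT (fun x : Leb R n => x 0 i).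
Proof.
apply: (measurability _ (RGenOInfty.measurableE R)) => _ [_ [c ->] <-].
rewrite setTI (_ : _ @^-1` _ = ~` [set x : Leb R n | x 0 i <= c]).
  exact/measurableC/measurable_halfspace.
by apply/seteqP; split => x /=; rewrite in_itv/= andbT ltNge => /negP.
Qed.

(** U is the union of the countably many open boxes with rational corners that it contains; balls of
    the sup norm are cubes, so every point of U lies in such a box. *)
Lemma open_measurable_leb (U : set 'rV[R]_n) :
  open U -> measurable (U : set (Leb R n)).
Proof.
move=> oU.
pose B (q : 'rV[rat]_n * 'rV[rat]_n) : set (Leb R n) :=
  [set x | forall i, ratr (q.1 0 i) < x 0 i < ratr (q.2 0 i)].
have mB q : measurable (B q).
  have -> : B q = \bigcap_(i in [set: 'I_n])
      (fun x : Leb R n => x 0 i) @^-1` `]ratr (q.1 0 i), ratr (q.2 0 i)[.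
    by apply/seteqP; split => x /= h i => [_|]; have := h i; rewrite /= in_itv//=; apply.
  apply: fin_bigcap_measurable => // i _; rewrite -[X in measurable X]setTI.
  exact: measurable_coord.
have -> : U = \bigcup_q (if `[< B q `<=` U >] then B q else set0).
  apply/seteqP; split => [x Ux|x [q _]]; last by case: asboolP => // /[apply].
  have /nbhs_ballP[e /= e0 eU] := open_nbhs_nbhs (conj oU Ux).
  have /choice[q hq] : forall i, exists q : rat * rat,
      x 0 i - e < ratr q.1 < x 0 i /\ x 0 i < ratr q.2 < x 0 i + e.
    move=> i.
    have [|q1 /[!in_itv]/= h1] := @rat_in_itvoo R (x 0 i - e) (x 0 i); first lra.
    have [|q2 /[!in_itv]/= h2] := @rat_in_itvoo R (x 0 i) (x 0 i + e); first lra.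
    by exists (q1, q2).
  exists (\row_i (q i).1, \row_i (q i).2) => //.
  case: asboolP => [_ i|nU].
    by rewrite /= !mxE; have [/andP[_ ->] /andP[-> _]] := hq i.
  exfalso; apply: nU => y By; apply: eU; split => // j i; rewrite (ord1 j).
  have := By i; rewrite /ball/= !mxE ltr_norml; have := hq i; lra.
apply: countable_bigcupT_measurable => [|q].
  exact: countableP.
by case: ifP.
Qed.

Lemma continuous_measurable_leb (f : 'rV[R]_n -> R) :
  continuous f -> measurable_fun setT (f : Leb R n -> R).
Proof.
move=> /continuousP cf; apply: (measurability _ (RGenOInfty.measurableE R)).
by move=> _ [_ [c ->] <-]; rewrite setTI; apply/open_measurable_leb/cf/interval_open.
Qed.

Lemma leb_complete : measure_is_complete (leb n : set (Leb R n) -> \bar R).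
Proof. exact: measure_is_complete_caratheodory. Qed.

End lebesgue_measurable_sets.

(** * Integration and square-integrable functions *)

Section complete_measure.
Context d (T : measurableType d) (R : realType) (mu : {measure set T -> \bar R}).
Hypothesis cmu : measure_is_complete mu.
Variables (D : set T) (mD : measurable D).
Implicit Types f g h l : T -> R.

Local Notation Int f := (mu.-integrable D (fun x => (f x)%:E)).

Lemma integrable_measurable_fun f : Int f -> measurable_fun D f.
Proof. by move=> /measurable_int/measurable_EFinP. Qed.

Lemma integrableD_EFin f g : Int f -> Int g -> Int (fun x => f x + g x).
Proof. by move=> If Ig; exact: (integrableD mD If Ig). Qed.

Lemma integrableZl_EFin t f : Int f -> Int (fun x => t * f x).
Proof. by move=> If; exact: (integrableZl mD t If). Qed.

Lemma integrableB_EFin f g : Int f -> Int g -> Int (fun x => f x - g x).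
Proof. by move=> If Ig; exact: (integrableB mD If Ig). Qed.

Lemma integrable_norm_EFin f : Int f -> Int (fun x => `|f x|).
Proof. by move=> If; exact: (integrable_norm If). Qed.

Lemma le_integrable_EFin f g :
  measurable_fun D f -> (forall x, D x -> `|f x| <= g x) ->
  Int g -> Int f.
Proof.
move=> mf fg Ig; apply: (le_integrable mD _ _ Ig); first exact/measurable_EFinP.
move=> x Dx; rewrite !abse_EFin lee_fin; apply: le_trans (fg _ Dx) _.
exact: ler_norm.
Qed.

Lemma ae_eq_measurable f g : f = g %[ae mu in D] ->
  measurable_fun D f -> measurable_fun D g.
Proof.
move=> fg /measurable_EFinP mf; apply/measurable_EFinP.
apply: (ae_measurable_fun cmu _ mf).
by apply: filterS fg => x h Dx /=; rewrite h.
Qed.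

Lemma ae_eq_integrable f g : f = g %[ae mu in D] -> Int f -> Int g.
Proof.
move=> fg If; have mf := integrable_measurable_fun If; have mg := ae_eq_measurable fg mf.
have /integrableP[_] := If => lty; apply/integrableP; split.
  exact/measurable_EFinP.
rewrite (ae_eq_integral (fun x => `|(f x)%:E|%E))//.
- by apply: measurableT_comp => //; exact/measurable_EFinP.
- by apply: measurableT_comp => //; exact/measurable_EFinP.
- by apply: filterS fg => x h Dx /=; rewrite h.
Qed.

Lemma ae_eq_Rintegral f g : f = g %[ae mu in D] -> Int f ->
  \int[mu]_(x in D) f x = \int[mu]_(x in D) g x.
Proof.
move=> fg If; congr fine; apply: ae_eq_integral => //.
- by case/integrableP : If.
- by case/integrableP : (ae_eq_integrable fg If).
- by apply: filterS fg => x h Dx /=; rewrite h.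
Qed.

Lemma ae_le_Rintegral f g : Int f -> Int g ->
  (\forall x \ae mu, D x -> f x <= g x) ->
  \int[mu]_(x in D) f x <= \int[mu]_(x in D) g x.
Proof.
(* Changing g on a null set makes the inequality hold at every point. *)
move=> If Ig fg; have gm : g = (fun x => Num.max (f x) (g x)) %[ae mu in D].
  by apply: filterS fg => x h Dx; apply/esym/max_idPr/h.
rewrite (ae_eq_Rintegral gm)//; apply: le_Rintegral => //.
  exact: ae_eq_integrable Ig.
by move=> x _; rewrite le_max lexx.
Qed.

Lemma integrable_between l h f : measurable_fun D f -> Int l -> Int h ->
  (\forall x \ae mu, D x -> l x <= f x <= h x) -> Int f.
Proof.
move=> mf Il Ih lfh.
(* Clamping f between l and h changes it on a null set only, and |l| + |h| dominates the result
   everywhere. *)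
pose g x := Num.max (l x) (Num.min (f x) (h x)).
have gf : g = f %[ae mu in D].
  apply: filterS lfh => x + Dx => /(_ Dx)/andP[lf fh].
  by rewrite /g (min_idPl fh) (max_idPr lf).
apply: (ae_eq_integrable gf); apply: (@le_integrable_EFin _ (fun x => `|l x| + `|h x|)).
- by apply: ae_eq_measurable mf; apply: filterS gf => x h' Dx; rewrite h'.
- move=> x _; rewrite /g.
  have l0 := normr_ge0 (l x); have h0 := normr_ge0 (h x).
  case: (leP (f x) (h x)) => h1; last by case: (leP (l x) (h x)) => h2; lra.
  case: (leP (l x) (f x)) => h2; last lra.
  have := ler_norm (h x); have := ler_norm (- l x); rewrite normrN ler_norml.
  by move=> h3 h4; apply/andP; split; lra.
- by apply: integrableD_EFin; exact: integrable_norm_EFin.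
Qed.

(** Replacing f_k by max(0, f_k) gives pointwise nonnegativity. The limit f agrees a.e. with the
    lower limit of these functions, so it is measurable by completeness of mu, and its integrability
    comes out of the bound c. *)
Lemma fatou_EFin (f_ : nat -> T -> R) f c : (forall k, Int (f_ k)) ->
  (forall k, \forall x \ae mu, D x -> 0 <= f_ k x) ->
  (\forall x \ae mu, D x -> (fun k => f_ k x) @ \oo --> f x) ->
  (forall k, \int[mu]_(x in D) f_ k x <= c) ->
  Int f /\ \int[mu]_(x in D) f x <= c.
Proof.
move=> If f0 ff fc.
pose g k x := Num.max 0 (f_ k x).
have gf k : f_ k = g k %[ae mu in D].
  by apply: filterS (f0 k) => x + Dx => /(_ Dx) h; rewrite /g (max_idPr h).
have Ig k : Int (g k) := ae_eq_integrable (gf k) (If k).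
have g0 k x : 0 <= g k x by rewrite le_max lexx.
have mg k : measurable_fun D (fun x => (g k x)%:E) by case/integrableP: (Ig k).
pose F x := limn_einf (fun k => (g k x)%:E).
have F0 x : (0 <= F x)%E.
  rewrite /F limn_einf_lim; apply: lime_ge; first exact: is_cvg_einfs.
  by apply: nearW => k; apply: le_ereal_inf_tmp => _ [j _ <-]; rewrite lee_fin.
have mF : measurable_fun D F.
  (* Measurability of the lower limit is reduced to that of an upper limit. *)
  have -> : F = (fun x => - limn_esup (fun k => (- g k x)%:E))%E by [].
  apply: measurableT_comp => //; apply: measurable_fun_limn_esup => k.
  by have /integrableP[] := integrableN (Ig k).
have Fc : (\int[mu]_(x in D) F x <= c%:E)%E.
  apply: le_trans (fatou mu mD mg _) _; first by move=> k x _; rewrite lee_fin.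
  rewrite limn_einf_lim; apply: lime_le; first exact: is_cvg_einfs.
  apply: nearW => k; apply: (@le_trans _ _ (\int[mu]_(x in D) (g k x)%:E)%E).
    by apply: ereal_inf_lbound; exists k => /=.
  rewrite -[leLHS]fineK; last exact: integrable_fin_num.
  by rewrite lee_fin -[X in X <= _]/(\int[mu]_(x in D) g k x) -(ae_eq_Rintegral (gf k)).
have Ff : F = (fun x => (f x)%:E) %[ae mu in D].
  have : \forall x \ae mu, forall k, D x -> f_ k x = g k x.
    by apply: ae_foralln => k; exact: gf.
  apply: filterS2 ff => x + fg Dx => /(_ Dx) fx.
  rewrite /F; suff : (fun k => (g k x)%:E) @ \oo --> (f x)%:E.
    by move=> /cvg_limn_einf_sup[->].
  apply: cvg_EFin; first exact: nearW.
  rewrite (_ : fine \o _ = (fun k => f_ k x))//; apply/funext => k.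
  by rewrite /= -fg.
have mf : measurable_fun D (fun x => (f x)%:E) := ae_measurable_fun cmu Ff mF.
have fE : (\int[mu]_(x in D) (f x)%:E = \int[mu]_(x in D) F x)%E.
  by apply: ae_eq_integral => //; apply: filterS Ff => x h Dx; rewrite h.
have If' : Int f.
  apply/integrableP; split => //.
  rewrite (ae_eq_integral F)//; first by rewrite (le_lt_trans Fc) ?ltry.
    exact: measurableT_comp.
  by apply: filterS Ff => x + Dx => /(_ Dx) h; rewrite -h gee0_abs.
split => //; rewrite -lee_fin; apply: le_trans Fc; rewrite -fE.
by rewrite -[leRHS]fineK//; exact: integrable_fin_num.
Qed.

Lemma Rintegral_comb a b f g h : Int f -> Int g -> Int h ->
  \int[mu]_(x in D) (a * f x - b * g x + h x) =
  a * (\int[mu]_(x in D) f x) - b * (\int[mu]_(x in D) g x) + \int[mu]_(x in D) h x.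
Proof.
move=> If Ig Ih; have Iaf := integrableZl_EFin a If; have Ibg := integrableZl_EFin b Ig.
rewrite RintegralD//; last exact: integrableB_EFin.
by rewrite RintegralB// !RintegralZl.
Qed.

Lemma RintegralN f : Int f ->
  \int[mu]_(x in D) (- f x) = - \int[mu]_(x in D) f x.
Proof.
move=> If; rewrite -mulN1r -RintegralZl//.
by apply: eq_Rintegral => x _; rewrite mulN1r.
Qed.

End complete_measure.

(** The form in (t, s) is tested at (- b, a) if a > 0, at (c, - b) if c > 0, and at (1, 1) and (1, -
    1) if a = c = 0. *)
Lemma discriminant_le (R : realFieldType) (a b c : R) : 0 <= a -> 0 <= c ->
  (forall t s, 0 <= t ^+ 2 * a + 2 * t * s * b + s ^+ 2 * c) -> b ^+ 2 <= a * c.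
Proof.
move=> a0 c0 h.
have [ap|an] := ltP 0 a.
  have := h (- b) a.
  have -> : (- b) ^+ 2 * a + 2 * (- b) * a * b + a ^+ 2 * c = a * (a * c - b ^+ 2).
    by ring.
  by rewrite pmulr_rge0// subr_ge0.
have [cp|cn] := ltP 0 c.
  have := h c (- b).
  have -> : c ^+ 2 * a + 2 * c * (- b) * b + (- b) ^+ 2 * c = c * (a * c - b ^+ 2).
    by ring.
  by rewrite pmulr_rge0// subr_ge0.
have a00 : a = 0 by lra.
have c00 : c = 0 by lra.
have := h 1 1; have := h 1 (- 1); rewrite a00 c00 => h1 h2.
have -> : b = 0 by lra.
by rewrite expr0n mulr0.
Qed.

Section square_integrable.
Context d (T : measurableType d) (R : realType) (mu : {measure set T -> \bar R}).
Variables (D : set T).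
Implicit Types f g h : T -> R.

(** Measurability of f is stated apart because that of its square does not imply it. *)
Definition sq_integrable f :=
  measurable_fun D f /\ mu.-integrable D (fun x => (f x ^+ 2)%:E).

Definition dotL2 f g := \int[mu]_(x in D) (f x * g x).

Definition sqnorm f := dotL2 f f.

Hypotheses (cmu : measure_is_complete mu) (mD : measurable D).

Local Notation Int f := (mu.-integrable D (fun x => (f x)%:E)).
Local Notation L2 := sq_integrable.

Lemma sq_integrable_mul f g : L2 f -> L2 g -> Int (fun x => f x * g x).
Proof.
move=> [mf If] [mg Ig].
apply: (@le_integrable_EFin _ _ _ mu _ mD _ (fun x => f x ^+ 2 + g x ^+ 2)).
- exact: measurable_funM.
- move=> x _; rewrite normrM -(real_normK (num_real (f x))).
  rewrite -(real_normK (num_real (g x))).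
  have := normr_ge0 (f x); have := normr_ge0 (g x); nra.
- exact: integrableD_EFin.
Qed.

Lemma sq_integrable_lin t f g : L2 f -> L2 g -> L2 (fun x => t * f x + g x).
Proof.
move=> L2f L2g; have [[mf If] [mg Ig]] := (L2f, L2g).
have m : measurable_fun D (fun x => t * f x + g x).
  by apply: measurable_funD => //; exact: measurable_funM.
split => //.
have -> : (fun x => ((t * f x + g x) ^+ 2)%:E) =
    (fun x => (t ^+ 2 * f x ^+ 2 + (2 * t * (f x * g x) + g x ^+ 2))%:E).
  by apply/funext => x; congr EFin; ring.
apply: integrableD_EFin => //; first exact: integrableZl_EFin.
apply: integrableD_EFin => //; apply: integrableZl_EFin => //.
exact: sq_integrable_mul.
Qed.

Lemma sq_integrable_sub f g : L2 f -> L2 g -> L2 (fun x => f x - g x).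
Proof.
move=> L2f L2g; have := sq_integrable_lin (-1) L2g L2f.
by congr L2; apply/funext => x; ring.
Qed.

Lemma sq_integrable_scale t f : L2 f -> L2 (fun x => t * f x).
Proof.
move=> L2f; have := sq_integrable_lin (t - 1) L2f L2f.
by congr L2; apply/funext => x; ring.
Qed.

Lemma sq_integrable0 : L2 (fun=> 0).
Proof.
split; first exact: measurable_cst.
by rewrite expr0n; exact: integrable0.
Qed.

Lemma dotL2C f g : dotL2 f g = dotL2 g f.
Proof. by apply: eq_Rintegral => x _; rewrite mulrC. Qed.

Lemma dotL2_linl t f g h : L2 f -> L2 g -> L2 h ->
  dotL2 (fun x => t * f x + g x) h = t * dotL2 f h + dotL2 g h.
Proof.
move=> L2f L2g L2h; rewrite /dotL2.
under eq_Rintegral => x _ do rewrite mulrDl -mulrA.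
have Ifh := sq_integrable_mul L2f L2h; have Igh := sq_integrable_mul L2g L2h.
rewrite RintegralD//; first by rewrite RintegralZl.
exact: (@integrableZl_EFin _ _ _ mu _ mD t (fun x => f x * h x)).
Qed.

Lemma dotL2_subl f g h : L2 f -> L2 g -> L2 h ->
  dotL2 (fun x => f x - g x) h = dotL2 f h - dotL2 g h.
Proof.
move=> L2f L2g L2h; rewrite -[RHS]addrC -mulN1r -dotL2_linl//.
by apply: eq_Rintegral => x _; rewrite mulN1r addrC.
Qed.

Lemma dotL2_scalel t f h : L2 f -> L2 h ->
  dotL2 (fun x => t * f x) h = t * dotL2 f h.
Proof.
move=> L2f L2h; rewrite -RintegralZl//; last exact: sq_integrable_mul.
by apply: eq_Rintegral => x _; rewrite mulrA.
Qed.

Lemma dotL2_scaler t f h : L2 f -> L2 h ->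
  dotL2 h (fun x => t * f x) = t * dotL2 h f.
Proof. by move=> L2f L2h; rewrite !(dotL2C h) dotL2_scalel. Qed.

Lemma sqnorm_scale t f : L2 f -> sqnorm (fun x => t * f x) = t ^+ 2 * sqnorm f.
Proof.
move=> L2f; rewrite /sqnorm dotL2_scalel ?dotL2_scaler//; last exact: sq_integrable_scale.
by rewrite mulrA.
Qed.

Lemma sqnorm_ge0 f : 0 <= sqnorm f.
Proof. by apply: Rintegral_ge0 => x _; rewrite -expr2 sqr_ge0. Qed.

Lemma sqnorm_lin t f g : L2 f -> L2 g ->
  sqnorm (fun x => t * f x + g x) =
  t ^+ 2 * sqnorm f + 2 * t * dotL2 f g + sqnorm g.
Proof.
move=> L2f L2g; have L2c := sq_integrable_lin t L2f L2g.
rewrite /sqnorm dotL2_linl// [dotL2 f _]dotL2C [dotL2 g _]dotL2C !dotL2_linl//.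
rewrite (dotL2C g f); ring.
Qed.

Lemma Rintegral_sqr_comb a b f g h : L2 f -> L2 g -> Int h ->
  \int[mu]_(x in D) (a * `|f x| ^+ 2 - b * `|g x| ^+ 2 + h x) =
  a * sqnorm f - b * sqnorm g + \int[mu]_(x in D) h x.
Proof.
move=> [mf If] [mg Ig] Ih; rewrite /sqnorm /dotL2 -(Rintegral_comb mD)//.
by apply: eq_Rintegral => x _; rewrite !real_normK ?num_real// !expr2.
Qed.

Lemma sqnorm_conv t f g : L2 f -> L2 g ->
  sqnorm (fun x => t * f x + (1 - t) * g x) =
  t * sqnorm f + (1 - t) * sqnorm g - t * (1 - t) * sqnorm (fun x => f x - g x).
Proof.
move=> L2f L2g; rewrite sqnorm_lin//; last exact: sq_integrable_scale.
have -> : sqnorm (fun x => f x - g x) = sqnorm f - 2 * dotL2 f g + sqnorm g.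
  have -> : (fun x => f x - g x) = (fun x => -1 * g x + f x).
    by apply/funext => x; ring.
  by rewrite sqnorm_lin// (dotL2C g f); ring.
by rewrite dotL2_scaler// sqnorm_scale//; ring.
Qed.

Lemma cauchy_schwarz f g : L2 f -> L2 g -> dotL2 f g ^+ 2 <= sqnorm f * sqnorm g.
Proof.
move=> L2f L2g; apply: discriminant_le; try exact: sqnorm_ge0.
move=> t s; have := sqnorm_ge0 (fun x => t * f x + s * g x).
rewrite sqnorm_lin//; last exact: sq_integrable_scale.
by rewrite dotL2_scaler// sqnorm_scale// !mulrA.
Qed.

Lemma ae_eq_dotL2 f f' g g' : f = f' %[ae mu in D] -> g = g' %[ae mu in D] ->
  L2 f -> L2 g -> dotL2 f g = dotL2 f' g'.
Proof.
move=> ff gg L2f L2g.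
apply: (ae_eq_Rintegral cmu mD _ (sq_integrable_mul L2f L2g)).
by apply: filterS2 ff gg => x h1 h2 Dx; rewrite h1// h2.
Qed.

Lemma sqnorm_eq0 f : L2 f -> sqnorm f = 0 -> f = cst 0 %[ae mu in D].
Proof.
move=> [mf If] f0.
have mf2 : measurable_fun D (fun x => (f x ^+ 2)%:E) by case/integrableP : If.
have /(ae_eq_integral_abs mu mD mf2) : (\int[mu]_(x in D) `|(f x ^+ 2)%:E| = 0)%E.
  transitivity (\int[mu]_(x in D) (f x ^+ 2)%:E)%E.
    by apply: eq_integral => x _; rewrite gee0_abs// lee_fin sqr_ge0.
  rewrite -[LHS]fineK; last exact: integrable_fin_num.
  by congr EFin; rewrite -[RHS]f0; apply: eq_Rintegral => x _; rewrite expr2.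
by apply: filterS => x + Dx => /(_ Dx) [/eqP]; rewrite sqrf_eq0 => /eqP.
Qed.

(* The series of the [4 ^+ k * h_ k x ^+ 2] is integrable, hence a.e. finite. *)
Lemma sqnorm_fast_ae_bound (h_ : nat -> T -> R) : (forall k, L2 (h_ k)) ->
  (forall k, sqnorm (h_ k) <= 8^-1 ^+ k) ->
  \forall x \ae mu, D x -> exists C, forall k, `|h_ k x| <= geometric C 2^-1 k.
Proof.
move=> L2h hle.
pose u k x := (4 ^+ k * h_ k x ^+ 2)%:E.
have Iu k : mu.-integrable D (u k).
  apply: (@integrableZl_EFin _ _ _ mu _ mD (4 ^+ k) (fun x => h_ k x ^+ 2)).
  by case: (L2h k).
have mu_ k : measurable_fun D (u k) by case/integrableP: (Iu k).
have u0 k x : D x -> (0 <= u k x)%E.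
  by move=> _; rewrite lee_fin; apply: mulr_ge0; [exact: exprn_ge0|exact: sqr_ge0].
pose F x := (\sum_(k <oo) u k x)%E.
have F0 x : D x -> (0 <= F x)%E by move=> Dx; apply: nneseries_ge0 => k _ _; exact: u0.
have mF : measurable_fun D F by apply: ge0_emeasurable_sum => // k x Dx _; exact: u0.
have IF : mu.-integrable D F.
  apply/integrableP; split => //.
  have -> : (\int[mu]_(x in D) `|F x| = \int[mu]_(x in D) F x)%E.
    by apply: eq_integral => x /set_mem Dx; rewrite gee0_abs// F0.
  (* The k-th integral is at most 4^k / 8^k = 2^-k, and these sum to 2. *)
  rewrite integral_nneseries//; apply: (@le_lt_trans _ _ 2%:E); last exact: ltry.
  apply: lime_le.
    by apply: is_cvg_nneseries => k _ _; apply: integral_ge0 => x; exact: u0.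
  apply: nearW => n.
  apply: (@le_trans _ _ (\sum_(0 <= k < n) (geometric 1 2^-1 k)%:E)%E).
    apply: lee_sum => k _.
    rewrite -[leLHS]fineK; last exact: integrable_fin_num.
    rewrite lee_fin (_ : fine _ = 4 ^+ k * sqnorm (h_ k)).
      apply: (@le_trans _ _ (4 ^+ k * 8^-1 ^+ k)); first by rewrite ler_pM2l ?exprn_gt0.
      by rewrite -exprMn /geometric /= mul1r (_ : 4 / 8 = 2^-1)//; field.
    rewrite /sqnorm /dotL2 -RintegralZl//; last exact: sq_integrable_mul.
  rewrite sumEFin lee_fin.
  have := @geometric_le_lim R n 1 2^-1 ler01 ltac:(lra).
  rewrite ger0_norm; last lra.
  move=> /(_ ltac:(lra)); rewrite seriesEnat => /le_trans; apply.
  by rewrite mul1r; have -> : 1 - 2^-1 = 2^-1 :> R by [field]; rewrite invrK.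
apply: filterS (integrable_ae mD IF) => x + Dx => /(_ Dx) Ffin.
(* With a = 2^k |h_k x|, one term of the series gives a^2 <= F x, hence a <= 1 + a^2 <= 1 + F x. *)
exists (1 + fine (F x)) => k.
have uF : (u k x <= F x)%E.
  apply: le_trans (nneseries_lim_ge k.+1 _); last by move=> n _ _; exact: u0.
  by rewrite big_nat_recr//= leeDr//; apply: sume_ge0 => i _; exact: u0.
have {uF} : 4 ^+ k * h_ k x ^+ 2 <= fine (F x) by rewrite -lee_fin fineK.
have -> : 4 ^+ k * h_ k x ^+ 2 = (2 ^+ k * `|h_ k x|) ^+ 2.
  rewrite exprMn real_normK ?num_real// -exprM mulnC exprM.
  by rewrite (_ : 2 ^+ 2 = 4)//; ring.
move=> hF; rewrite /geometric/= exprVn ler_pdivlMr ?exprn_gt0// mulrC.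
have : 0 <= fine (F x) by rewrite fine_ge0// F0.
have : 0 <= 2 ^+ k * `|h_ k x| by rewrite mulr_ge0// exprn_ge0.
move: hF; move: (2 ^+ k * _) (fine _) => a b; nra.
Qed.

(** The increments are a.e. dominated by a geometric sequence, so their telescoping series converges
    absolutely. *)
Lemma sqnorm_fast_ae_cvg (f_ : nat -> T -> R) : (forall k, L2 (f_ k)) ->
  (forall k, sqnorm (fun x => f_ k.+1 x - f_ k x) <= 8^-1 ^+ k) ->
  \forall x \ae mu, D x -> cvgn (f_ ^~ x).
Proof.
move=> L2f fle.
have L2d k : L2 (fun x => f_ k.+1 x - f_ k x) by exact: sq_integrable_sub.
apply: filterS (sqnorm_fast_ae_bound L2d fle) => x + Dx => /(_ Dx)[C hC].
have : cvgn (series (telescope (f_ ^~ x))).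
  apply: normed_cvg; apply: (series_le_cvg _ _ hC) => //.
    by move=> n; apply: le_trans (hC n).
  by apply: is_cvg_geometric_series; rewrite ger0_norm; lra.
rewrite telescopeK => cf.
have -> : f_ ^~ x = (fun n => (f_ n x - f_ 0%N x) + f_ 0%N x).
  by apply/funext => n; rewrite subrK.
exact: is_cvgD cf (is_cvg_cst _).
Qed.

Lemma ae_cvg_measurable (f_ : nat -> T -> R) f :
  (forall k, measurable_fun D (f_ k)) ->
  (\forall x \ae mu, D x -> (fun k => f_ k x) @ \oo --> f x) ->
  measurable_fun D f.
Proof.
move=> mf ff; apply/measurable_EFinP.
apply: (ae_measurable_fun cmu _
  (@measurable_fun_limn_esup _ _ _ D (fun k x => (f_ k x)%:E) _)).
  apply: filterS ff => x + Dx => /(_ Dx) fx.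
  suff /cvg_limn_einf_sup[_ ->] : (fun k => (f_ k x)%:E) @ \oo --> (f x)%:E by [].
  by apply: cvg_EFin => //; exact: nearW.
by move=> k; exact/measurable_EFinP.
Qed.

Lemma sqnorm_fatou (f_ : nat -> T -> R) f c : (forall k, L2 (f_ k)) ->
  (\forall x \ae mu, D x -> (fun k => f_ k x) @ \oo --> f x) ->
  (forall k, sqnorm (f_ k) <= c) -> L2 f /\ sqnorm f <= c.
Proof.
move=> L2f ff fc.
have mf : measurable_fun D f by apply: ae_cvg_measurable ff => k; case: (L2f k).
have [||||] := @fatou_EFin _ _ _ mu cmu D mD (fun k x => f_ k x * f_ k x)
  (fun x => f x * f x) c.
- by move=> k; exact: sq_integrable_mul.
- by move=> k; apply: aeW => x _; rewrite -expr2 sqr_ge0.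
- by apply: filterS ff => x + Dx => /(_ Dx) fx; exact: cvgM.
- exact: fc.
by move=> If; split => //; split => //; under eq_fun do rewrite expr2.
Qed.

Lemma sq_integrable_complete (f_ : nat -> T -> R) : (forall k, L2 (f_ k)) ->
  (forall e, 0 < e -> exists N, forall j k, (N <= j)%N -> (N <= k)%N ->
    sqnorm (fun x => f_ j x - f_ k x) < e) ->
  exists2 f, L2 f & forall e, 0 < e ->
    exists N, forall k, (N <= k)%N -> sqnorm (fun x => f_ k x - f x) < e.
Proof.
move=> L2f cauchy.
have e0 k : 0 < 8^-1 ^+ k :> R by rewrite exprn_gt0.
have /choice[N hN] := fun k => cauchy _ (e0 k).
(* The index s k lies beyond N m for every m <= k, so consecutive terms of the subsequence are 8^-k
   close. *)
pose s k := (\sum_(i < k.+1) N i)%N.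
have Ns m k : (m <= k)%N -> (N m <= s k)%N.
  rewrite -ltnS => mk; rewrite /s (bigD1 (Ordinal mk))//=; exact: leq_addr.
have fast : \forall x \ae mu, D x -> cvgn (fun k => f_ (s k) x).
  apply: (@sqnorm_fast_ae_cvg (fun k => f_ (s k))) => // k.
  by apply/ltW/hN; apply: Ns.
pose f x := limn (fun k => f_ (s k) x).
(* Fatou's lemma in k for f_j - f_(s (k + m)): the Cauchy bound passes to f_j - f, and so does
   square integrability, from which that of f follows. *)
have dist m j : (N m <= j)%N ->
    L2 (fun x => f_ j x - f x) /\ sqnorm (fun x => f_ j x - f x) <= 8^-1 ^+ m.
  move=> Nj; apply: (@sqnorm_fatou (fun k x => f_ j x - f_ (s (k + m)%N) x)).
  - by move=> k; exact: sq_integrable_sub.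
  - apply: filterS fast => x + Dx => /(_ Dx) fx; apply: cvgB; first exact: cvg_cst.
    by rewrite (cvg_shiftn m (fun k => f_ (s k) x)).
  - by move=> k; apply/ltW/hN => //; apply: Ns; exact: leq_addl.
have L2lim : L2 f.
  have := sq_integrable_sub (L2f (N 0%N)) (dist 0%N (N 0%N) (leqnn _)).1.
  by congr L2; apply/funext => x; rewrite subKr.
exists f => // e ep.
have [m hm] : exists m, 8^-1 ^+ m < e.
  have /cvgrPdist_lt/(_ e ep)[m _ hm] : (fun n => 8^-1 ^+ n : R) @ \oo --> 0.
    by apply: cvg_expr; rewrite ger0_norm; lra.
  by exists m; have := hm m (leqnn _); rewrite /= sub0r normrN ger0_norm// ltW.
by exists (N m) => k /dist[_ /le_lt_trans]; exact.
Qed.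

Lemma sqnorm_cvg_ae_subseq (f_ : nat -> T -> R) f : (forall k, L2 (f_ k)) -> L2 f ->
  (forall e, 0 < e -> exists N, forall k, (N <= k)%N ->
    sqnorm (fun x => f_ k x - f x) < e) ->
  exists2 s : nat -> nat, (forall k, (k <= s k)%N) &
    \forall x \ae mu, D x -> (fun k => f_ (s k) x) @ \oo --> f x.
Proof.
move=> L2f L2g ff.
have e0 k : 0 < 8^-1 ^+ k :> R by rewrite exprn_gt0.
have /choice[N hN] := fun k => ff _ (e0 k).
(* The maximum with k ensures k <= s k, so that limits of scalar sequences carry over to the
   subsequence. *)
exists (fun k => maxn k (N k)) => [k|]; first exact: leq_maxl.
pose h k x := f_ (maxn k (N k)) x - f x.
have L2h k : L2 (h k) by exact: sq_integrable_sub.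
have hle k : sqnorm (h k) <= 8^-1 ^+ k by apply/ltW/hN; exact: leq_maxr.
apply: filterS (sqnorm_fast_ae_bound L2h hle) => x + Dx => /(_ Dx)[C hC].
have g0 : geometric C 2^-1 @ \oo --> (0 : R).
  by apply: cvg_geometric; rewrite ger0_norm; lra.
apply/cvgrPdist_lt => e ep; move/cvgrPdist_lt : g0 => /(_ e ep).
apply: filterS => k; rewrite sub0r normrN distrC; apply: le_lt_trans.
exact: le_trans (hC k) (ler_norm _).
Qed.

(** Square integrability of f_k is asked for large k only, since this is what [L2_cvg], a limit of
    extended real norms, provides. *)
Lemma dotL2_cvg (f_ : nat -> T -> R) f h : L2 f -> L2 h ->
  (forall e, 0 < e -> exists N, forall k, (N <= k)%N ->
    L2 (f_ k) /\ sqnorm (fun x => f_ k x - f x) < e) ->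
  (fun k => dotL2 h (f_ k)) @ \oo --> dotL2 h f.
Proof.
move=> L2f L2h ff; apply/cvgrPdist_lt => e e0.
have h0 : 0 < sqnorm h + 1 by rewrite ltr_wpDl ?sqnorm_ge0.
have [N hN] := ff _ (divr_gt0 (exprn_gt0 2 e0) h0).
exists N => // k /= /hN[L2fk].
have L2d := sq_integrable_sub L2fk L2f.
rewrite ltr_pdivlMr// => lte.
have := cauchy_schwarz L2h L2d; rewrite dotL2C dotL2_subl// !(dotL2C _ h).
rewrite distrC => h1; rewrite -(@ltr_pXn2r _ 2)// ?nnegrE ?ltW//.
rewrite real_normK ?num_real//.
apply: le_lt_trans h1 _; apply: le_lt_trans lte.
by rewrite mulrC ler_wpM2l ?sqnorm_ge0// lerDl.
Qed.

Lemma sqnorm_cvg (f_ : nat -> T -> R) f : L2 f -> (forall k, L2 (f_ k)) ->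
  (forall e, 0 < e -> exists N, forall k, (N <= k)%N ->
    sqnorm (fun x => f_ k x - f x) < e) ->
  (fun k => sqnorm (f_ k)) @ \oo --> sqnorm f.
Proof.
move=> L2f L2f_ ff.
have dcvg : (fun k => dotL2 f (f_ k)) @ \oo --> sqnorm f.
  by apply: dotL2_cvg => // e /ff[N hN]; exists N => k /hN.
have d0 : (fun k => sqnorm (fun x => f_ k x - f x)) @ \oo --> (0 : R).
  apply/cvgrPdist_lt => e /ff[N hN]; exists N => // k /= /hN.
  by rewrite sub0r normrN ger0_norm ?sqnorm_ge0.
have -> : (fun k => sqnorm (f_ k)) =
    (fun k => sqnorm (fun x => f_ k x - f x) + 2 * dotL2 f (f_ k) - sqnorm f).
  apply/funext => k.
  have -> : (fun x => f_ k x - f x) = (fun x => -1 * f x + f_ k x).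
    by apply/funext => x; ring.
  by rewrite sqnorm_lin//; ring.
suff : (fun k => sqnorm (fun x => f_ k x - f x) + 2 * dotL2 f (f_ k) - sqnorm f)
    @ \oo --> 0 + 2 * sqnorm f - sqnorm f.
  by rewrite (_ : 0 + 2 * sqnorm f - sqnorm f = sqnorm f)//; ring.
by apply: cvgB; [apply: cvgD => //; apply: cvgM => //; exact: cvg_cst|exact: cvg_cst].
Qed.

End square_integrable.

(** * Orthonormal systems *)

Section orthonormal.
Context d (T : measurableType d) (R : realType) (mu : {measure set T -> \bar R}).
Variables (D : set T).
Hypotheses (cmu : measure_is_complete mu) (mD : measurable D).
Variable z : nat -> T -> R.

Local Notation L2 := (sq_integrable mu D).
Local Notation dot := (dotL2 mu D).
Local Notation nrm2 := (sqnorm mu D).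

Hypothesis L2z : forall k, L2 (z k).
Hypothesis zz : forall j k, dot (z j) (z k) = (j == k)%:R.
Hypothesis z_complete : forall f, L2 f -> (forall k, dot f (z k) = 0) ->
  f = cst 0 %[ae mu in D].

Implicit Types (f g h : T -> R) (a : nat -> R).

Definition psum a N : T -> R := fun x => \sum_(k < N) a k * z k x.

Lemma psum0 a : psum a 0 = fun=> 0.
Proof. by apply/funext => x; rewrite /psum big_ord0. Qed.

Lemma psumS a N : psum a N.+1 = fun x => a N * z N x + psum a N x.
Proof. by apply/funext => x; rewrite /psum big_ord_recr addrC. Qed.

Lemma sq_integrable_psum a N : L2 (psum a N).
Proof.
elim: N => [|N ih]; first by rewrite psum0; exact: sq_integrable0.
by rewrite psumS; exact: sq_integrable_lin.
Qed.

Lemma dot_psum a N f : L2 f -> dot (psum a N) f = \sum_(k < N) a k * dot (z k) f.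
Proof.
move=> L2f; elim: N => [|N ih].
  rewrite psum0 big_ord0 -[RHS](mul0r (dot f f)) -dotL2_scalel//.
  by apply: eq_Rintegral => x _; rewrite !mul0r.
by rewrite psumS dotL2_linl// ?ih ?big_ord_recr 1?addrC//; exact: sq_integrable_psum.
Qed.

Lemma dot_psum_z a N k : dot (psum a N) (z k) = if (k < N)%N then a k else 0.
Proof.
rewrite dot_psum//; under eq_bigr do rewrite zz.
case: ifPn => kN.
  rewrite (bigD1 (Ordinal kN))//= eqxx mulr1 big1 ?addr0// => i /negbTE ik.
  by rewrite -val_eqE/= in ik; rewrite ik mulr0.
rewrite big1// => i _; case: eqP => [ik|_]; last by rewrite mulr0.
by move: kN; rewrite -ik ltn_ord.
Qed.

Lemma dot_psums a M N : (M <= N)%N ->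
  dot (psum a M) (psum a N) = \sum_(k < M) a k ^+ 2.
Proof.
move=> MN; rewrite dot_psum; last exact: sq_integrable_psum.
apply: eq_bigr => k _; rewrite dotL2C dot_psum_z (leq_trans (ltn_ord k))//.
Qed.

Lemma sqnorm_sub f g : L2 f -> L2 g ->
  nrm2 (fun x => f x - g x) = nrm2 f - 2 * dot f g + nrm2 g.
Proof.
move=> L2f L2g; have -> : (fun x => f x - g x) = (fun x => -1 * g x + f x).
  by apply/funext => x; ring.
by rewrite sqnorm_lin// (dotL2C _ _ g f); ring.
Qed.

Lemma sqnorm_subC f g : nrm2 (fun x => f x - g x) = nrm2 (fun x => g x - f x).
Proof. by apply: eq_Rintegral => x _; ring. Qed.

Lemma sqnorm_psum_sub a M N : (M <= N)%N ->
  nrm2 (fun x => psum a N x - psum a M x) =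
  \sum_(k < N) a k ^+ 2 - \sum_(k < M) a k ^+ 2.
Proof.
move=> MN; rewrite sqnorm_sub; try exact: sq_integrable_psum.
by rewrite dotL2C /sqnorm !dot_psums//; ring.
Qed.

Lemma dot_sqr_le f g k : L2 f -> L2 g ->
  (dot f (z k) - dot g (z k)) ^+ 2 <= nrm2 (fun x => f x - g x).
Proof.
move=> L2f L2g; rewrite -dotL2_subl//.
apply: le_trans (cauchy_schwarz mD _ (L2z k)) _; first exact: sq_integrable_sub.
by rewrite {2}/sqnorm zz eqxx mulr1.
Qed.

(** Shaped for partial sums of an expansion, whose k-th coefficient is constant from index k + 1
    on. *)
Lemma dot_lim (f_ : nat -> T -> R) f k l : (forall j, L2 (f_ j)) -> L2 f ->
  (forall e, 0 < e -> exists N, forall j, (N <= j)%N ->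
    nrm2 (fun x => f_ j x - f x) < e) ->
  (exists N, forall j, (N <= j)%N -> dot (f_ j) (z k) = l) ->
  dot f (z k) = l.
Proof.
move=> L2f_ L2f ff [N hN]; apply/eqP; rewrite eq_sym -subr_eq0 -sqrf_eq0.
rewrite eq_le sqr_ge0 andbT; apply/ler_addgt0Pr => e /ff[M hM].
rewrite add0r -(hN _ (leq_maxl N M)); apply: le_trans (dot_sqr_le _ _ _) _ => //.
exact/ltW/hM/leq_maxr.
Qed.

(** By orthonormality, squared distances between partial sums are differences of a bounded
    increasing sequence, so the partial sums are Cauchy. *)
Theorem riesz_fischer a C : (forall n, \sum_(k < n) a k ^+ 2 <= C) ->
  exists f, [/\ L2 f, forall k, dot f (z k) = a k & forall e, 0 < e ->
    exists N, forall n, (N <= n)%N -> nrm2 (fun x => psum a n x - f x) < e].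
Proof.
move=> aC; pose s n := \sum_(k < n) a k ^+ 2.
have sS n : s n <= s n.+1 by rewrite /s big_ord_recr lerDl sqr_ge0.
have smono m n : (m <= n)%N -> s m <= s n.
  by move=> mn; apply: (homo_leq lexx le_trans sS).
have sups : has_sup (range s).
  by split; [exists (s 0%N), 0%N|exists C => _ [n _ <-]; exact: aC].
have sle n : s n <= sup (range s) by apply: ub_le_sup; [case: sups|exists n].
have [||f L2f ff] := @sq_integrable_complete _ _ _ mu D cmu mD (psum a).
- exact: sq_integrable_psum.
- move=> e e0; have [_ [N _ <-] hN] := sup_adherent e0 sups; exists N => j k Nj Nk.
  have hj := smono _ _ Nj; have hk := smono _ _ Nk.
  have sj := sle j; have sk := sle k.
  have [jk|/ltnW jk] := leqP k j; last rewrite sqnorm_subC.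
    by rewrite sqnorm_psum_sub// -/(s j) -/(s k); lra.
  by rewrite sqnorm_psum_sub// -/(s j) -/(s k); lra.
exists f; split => // k; apply: dot_lim L2f ff _.
  exact: sq_integrable_psum.
by exists k.+1 => j kj; rewrite dot_psum_z kj.
Qed.

Lemma bessel f n : L2 f -> \sum_(k < n) dot f (z k) ^+ 2 <= nrm2 f.
Proof.
move=> L2f; set a := fun k => dot f (z k).
have := sqnorm_ge0 mu D (fun x => f x - psum a n x).
rewrite sqnorm_sub//; last exact: sq_integrable_psum.
rewrite {2}/sqnorm dot_psums// dotL2C dot_psum//.
under eq_bigr do rewrite dotL2C -expr2.
lra.
Qed.

Lemma ae_eq_coef f g : L2 f -> L2 g -> (forall k, dot f (z k) = dot g (z k)) ->
  f = g %[ae mu in D].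
Proof.
move=> L2f L2g fg; have := z_complete (sq_integrable_sub mD L2f L2g) _.
move=> h; have {h} : (fun x => f x - g x) = cst 0 %[ae mu in D].
  by apply: h => k; rewrite dotL2_subl// fg subrr.
by apply: filterS => x + Dx => /(_ Dx)/= /eqP; rewrite subr_eq0 => /eqP.
Qed.

(** By Bessel's inequality the partial sums have a limit; it has the coefficients of f, hence equals
    f a.e. by completeness of z. *)
Lemma psum_cvg f : L2 f -> forall e, 0 < e -> exists N, forall n, (N <= n)%N ->
  nrm2 (fun x => psum (fun k => dot f (z k)) n x - f x) < e.
Proof.
move=> L2f e e0; have [g [L2g gf gcvg]] 
    := @riesz_fischer (fun k => dot f (z k)) _ (fun n => bessel n L2f).
have [N hN] := gcvg _ e0; exists N => n /hN; congr (_ < _).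
have gfae := ae_eq_coef L2g L2f gf.
have h : (fun x => psum (fun k => dot f (z k)) n x - g x) =
    (fun x => psum (fun k => dot f (z k)) n x - f x) %[ae mu in D].
  by apply: filterS gfae => x h Dx; rewrite h.
by apply: ae_eq_dotL2 => //; apply: sq_integrable_sub => //; exact: sq_integrable_psum.
Qed.

Lemma parseval_le f C : L2 f -> (forall n, \sum_(k < n) dot f (z k) ^+ 2 <= C) ->
  nrm2 f <= C.
Proof.
move=> L2f fC; apply/ler_addgt0Pr => e /(psum_cvg L2f)[N /(_ N (leqnn _))].
have L2p := sq_integrable_psum (fun k => dot f (z k)) N.
rewrite sqnorm_sub// {1}/sqnorm dot_psums// dot_psum//.
under [in X in _ - 2 * X]eq_bigr do rewrite (dotL2C mu D (z _) f) -expr2.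
have := fC N; lra.
Qed.

Lemma parseval_nneseries f : L2 f ->
  (\sum_(k <oo) (dot f (z k) ^+ 2)%:E = (nrm2 f)%:E)%E.
Proof.
move=> L2f; have c0 k : (0 <= (dot f (z k) ^+ 2)%:E)%E by rewrite lee_fin sqr_ge0.
apply/eqP; rewrite eq_le; apply/andP; split.
  apply: lime_le; first by apply: is_cvg_nneseries.
  by apply: nearW => n; rewrite sumEFin lee_fin big_mkord bessel.
set s := (X in (_ <= X)%E).
have sge n : ((\sum_(k < n) dot f (z k) ^+ 2)%:E <= s)%E.
  rewrite -sumEFin -(big_mkord xpredT (fun k => (dot f (z k) ^+ 2)%:E)).
  exact: nneseries_lim_ge.
case: s sge => [r|_|/(_ 0%N)]; last by rewrite big_ord0.
  by move=> sge; rewrite lee_fin parseval_le// => n; rewrite -lee_fin.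
by rewrite leey.
Qed.

End orthonormal.

(** * The L^2 notions on Omega *)

Section leb_L2.
Context {R : realType} {n : nat}.
Variable Omega : set (Leb R n).
Hypothesis mO : measurable Omega.
Implicit Types f g : Leb R n -> R.

Local Notation L2 := (sq_integrable (leb n) Omega).
Local Notation dot := (dotL2 (leb n) Omega).
Local Notation nrm2 := (sqnorm (leb n) Omega).

Lemma L2_norm_lty f : measurable_fun Omega f -> (L2_norm Omega f < +oo)%E -> L2 f.
Proof.
move=> mf flty; split => //.
have mfO : measurable_fun setT (f \_ Omega) by apply/(measurable_restrictT _ mO).
have /Lfun2_integrable_sqr : f \_ Omega \in Lfun (leb n) 2%:E.
  by rewrite inE; apply/andP; split; rewrite inE.
move=> h; apply/(integrable_mkcond _ mO); move: h; congr integrable.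
apply/funext => x /=; rewrite /patch; case: ifP => // _; first by rewrite expr0n.
Qed.

Lemma L2_norm_integral f :
  (L2_norm Omega f = (\int[leb n]_(x in Omega) (f x ^+ 2)%:E) `^ 2^-1)%E.
Proof.
rewrite /L2_norm unlock; congr (_ `^ _)%E; rewrite [RHS]integral_mkcond.
apply: eq_integral => x _; rewrite /patch /=; case: ifP => _.
  by rewrite /= powR_mulrn// real_normK ?num_real.
by rewrite /= normr0 powR0 ?pnatr_eq0.
Qed.

Lemma L2_normE f : L2 f -> L2_norm Omega f = (Num.sqrt (nrm2 f))%:E.
Proof.
move=> L2f; rewrite L2_norm_integral.
rewrite -[X in (X `^ _)%E]fineK; last by apply: integrable_fin_num => //; case: L2f.
rewrite poweR_EFin powR12_sqrt; last first.
  by apply: fine_ge0; apply: integral_ge0 => x _; rewrite lee_fin sqr_ge0.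
by congr (Num.sqrt _)%:E; congr fine; apply: eq_integral => x _; rewrite expr2.
Qed.

Lemma Lp2P f : Lp Omega 2%:E f <-> L2 f.
Proof.
split=> [|L2f]; rewrite /Lp/=.
  rewrite inE => /andP[/[!inE]/= mf fin].
  by apply: L2_norm_lty => //; apply/(measurable_restrictT _ mO).
rewrite inE; apply/andP; split; rewrite inE/=.
  by apply/(measurable_restrictT _ mO); case: L2f.
by rewrite /finite_norm -[X in (X < _)%E]/(L2_norm Omega f) L2_normE// ltry.
Qed.

Lemma Lp1_integrable f : Lp Omega 1%:E f ->
  (leb n).-integrable Omega (fun x => (f x)%:E).
Proof.
move=> /Lfun1_integrable h; apply/(integrable_mkcond _ mO).
by move: h; congr integrable; apply/funext => x /=; rewrite /patch; case: ifP.
Qed.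

(** Extended real norms that tend to 0 are finite from some index on, and there f_k = (f_k - f) + f
    is square integrable. *)
Lemma L2_cvg_eventually (f_ : nat -> Leb R n -> R) f :
  (forall k, measurable_fun Omega (f_ k)) -> L2 f -> L2_cvg Omega f_ f ->
  forall e, 0 < e -> exists N, forall k, (N <= k)%N ->
    L2 (f_ k) /\ nrm2 (fun x => f_ k x - f x) < e.
Proof.
move=> mf_ L2f /fine_cvgP[[N1 _ hN1] /cvgrPdist_lt h] e e0.
have se0 : 0 < Num.sqrt e by rewrite sqrtr_gt0.
have [N2 _ hN2] := h _ se0; exists (maxn N1 N2) => k; rewrite geq_max => /andP[k1 k2].
have L2d : L2 (fun x => f_ k x - f x).
  apply: L2_norm_lty; last by have /= := hN1 _ k1; rewrite ltey_eq => ->.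
  by apply: measurable_funB => //; case: L2f.
split.
  have := sq_integrable_lin mO 1 L2d L2f.
  by congr sq_integrable; apply/funext => x; rewrite mul1r subrK.
have := hN2 _ k2; rewrite /= L2_normE//= sub0r normrN ger0_norm ?sqrtr_ge0//.
by rewrite ltr_sqrt.
Qed.

Lemma L2_cvgP (f_ : nat -> Leb R n -> R) f : (forall k, L2 (f_ k)) -> L2 f ->
  L2_cvg Omega f_ f <-> forall e, 0 < e -> exists N, forall k, (N <= k)%N ->
    nrm2 (fun x => f_ k x - f x) < e.
Proof.
move=> L2f_ L2f; split=> [h e e0|h].
  have mf_ k : measurable_fun Omega (f_ k) by case: (L2f_ k).
  have [N hN] := L2_cvg_eventually mf_ L2f h e0.
  by exists N => k /hN[].
have L2d k : L2 (fun x => f_ k x - f x) by exact: sq_integrable_sub.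
rewrite /L2_cvg; under eq_cvg do rewrite L2_normE//.
apply: cvg_EFin; first exact: nearW.
apply/cvgrPdist_lt => e e0; have [N hN] := h _ (exprn_gt0 2 e0).
exists N => // k /= /hN.
rewrite sub0r normrN ger0_norm ?sqrtr_ge0// -[in X in _ -> X](ger0_norm (ltW e0)).
by rewrite -sqrtr_sqr ltr_sqrt// exprn_gt0.
Qed.

Lemma L2_cvg_dot (f_ : nat -> Leb R n -> R) f h :
  (forall k, measurable_fun Omega (f_ k)) -> L2 f -> L2 h -> L2_cvg Omega f_ f ->
  (fun k => dot h (f_ k)) @ \oo --> dot h f.
Proof.
by move=> mf_ L2f L2h ff; apply: dotL2_cvg => //; exact: L2_cvg_eventually.
Qed.

Section eigensystem.
Hypothesis oO : open (Omega : set 'rV[R]_n).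

Lemma test_function_measurable (phi : 'rV[R]_n -> R) : test_function Omega phi ->
  measurable_fun Omega (phi : Leb R n -> R) /\
  forall i, measurable_fun Omega (partial i phi : Leb R n -> R).
Proof.
move=> [sm _]; split=> [|i]; apply: measurable_funTS; apply: continuous_measurable_leb.
  by have [] := sm [::].
by have [] := sm [:: i].
Qed.

(* Testing the weak formulation with test functions converging to z gives
   the Rayleigh identity [sum_i |g_i|^2 = rho |z|^2]. *)
Lemma eigenvalue_ge0 (z : Leb R n -> R) rho : dirichlet_eigenfunction Omega z rho ->
  0 <= rho.
Proof.
move=> [z0 [g [[/Lp2P L2z L2g [phi [tphi phiz phig]]] weak]]].
have {}L2g i : L2 (g i) by apply/Lp2P.
have mphi j := (test_function_measurable (tphi j)).1.
have mphi' i j := (test_function_measurable (tphi j)).2 i.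
have lhs : (fun j => \sum_i dot (g i) (partial i (phi j))) @ \oo -->
    \sum_i nrm2 (g i).
  apply: cvg_big => [|i _]; first exact: add_continuous.
  exact: (L2_cvg_dot (mphi' i) (L2g i) (L2g i) (phig i)).
have rhs : (fun j => rho * dot z (phi j)) @ \oo --> rho * nrm2 z.
  by apply: cvgM; [exact: cvg_cst|exact: (L2_cvg_dot mphi L2z L2z phiz)].
have E : \sum_i nrm2 (g i) = rho * nrm2 z.
  rewrite -(cvg_lim (@Rhausdorff R) lhs) -(cvg_lim (@Rhausdorff R) rhs).
  by congr (lim (_ @ \oo)); apply/funext => j; exact: weak.
have z1 : 0 < nrm2 z.
  rewrite lt_neqAle sqnorm_ge0 andbT eq_sym; apply/eqP => /(sqnorm_eq0 mO L2z).
  exact: z0.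
rewrite -(pmulr_lge0 _ z1) -E; apply: sumr_ge0 => i _; exact: sqnorm_ge0.
Qed.

End eigensystem.
End leb_L2.

(** * Measurability of compositions with Caratheodory functions *)

Lemma measurable_fun_countable d (T : measurableType d) (R : realType) (D : set T)
    (U : countType) (g : T -> U) (F : U -> T -> R) :
  (forall c, measurable (D `&` [set x | g x = c])) ->
  (forall c, measurable_fun D (F c)) -> measurable_fun D (fun x => F (g x) x).
Proof.
move=> mg mF mD Y mY.
have -> : D `&` (fun x => F (g x) x) @^-1` Y =
    \bigcup_c ((D `&` [set x | g x = c]) `&` (D `&` F c @^-1` Y)).
  apply/seteqP; split => [x [Dx Yx]|x [c _ [[Dx <-] [_ Yx]]]]; last by split.
  by exists (g x).
apply: countable_bigcupT_measurable; first exact: countableP.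
by move=> c; apply: measurableI => //; exact: mF.
Qed.

Section floor_approx.
Context {R : realType}.
Implicit Types (t : R) (k : nat).

(** The number t is rounded down to a multiple of 1 / (k + 1). Keeping the integer numerator apart
    from the real value [app] makes the approximations range over a countable type. *)
Let dig k t : int := Num.floor (k.+1%:R * t).

Let app k (a : int) : R := a%:~R / k.+1%:R.

Lemma floor_approx_lt k t : `|t - app k (dig k t)| < k.+1%:R^-1 *+ 2.
Proof.
have k0 : 0 < k.+1%:R :> R by rewrite ltr0n.
have := floor_itv (k.+1%:R * t); rewrite intrD /= => /andP[h1 h2].
have -> : t - app k (dig k t) = (k.+1%:R * t - (dig k t)%:~R) / k.+1%:R.
  by rewrite /app; field; rewrite gt_eqF.
rewrite normrM [X in _ * X]gtr0_norm ?invr_gt0// -[_ *+ 2]mulr_natl ltr_pM2r ?invr_gt0//.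
rewrite ger0_norm ?subr_ge0//; rewrite -/(dig k t) in h2; lra.
Qed.

Lemma floor_approx_cvg (e : R) : 0 < e ->
  \forall k \near \oo, forall t, `|t - app k (dig k t)| < e.
Proof.
move=> e0; have e2 : 0 < e / 2 by rewrite divr_gt0.
exists (Num.truncn (e / 2)^-1) => // k /= Nk t; apply: lt_trans (floor_approx_lt k t) _.
rewrite -[_ *+ 2]mulr_natr -ltr_pdivlMr// invf_plt ?posrE//.
by rewrite (lt_le_trans (truncnS_gt _))// ler_nat.
Qed.

Lemma measurable_floor_fiber d (T : measurableType d) (D : set T) (u : T -> R) k c :
  measurable D -> measurable_fun D u ->
  measurable (D `&` [set x | dig k (u x) = c]).
Proof.
move=> mD mu.
have -> : [set x | dig k (u x) = c] =
    (fun x => k.+1%:R * u x) @^-1` `[c%:~R, (c + 1)%:~R[.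
  apply/seteqP; split => x /=; rewrite in_itv/= -floor_eq /dig.
    by move=> /eqP.
  by move=> /eqP.
by apply: measurable_funM => //; exact: measurable_cst.
Qed.

Context {n m : nat} (Omega : set (Leb R n)).
Hypothesis mO : measurable Omega.

(* Replacing u, v, w by countably valued approximations gives measurable
   functions, which converge where f x is continuous. *)
Lemma measurable_caratheodory_comp (f : Leb R n -> R -> R -> 'rV[R]_m -> R)
    (u v : Leb R n -> R) (w : Leb R n -> 'rV[R]_m) :
  caratheodory_fun Omega f -> measurable_fun Omega u -> measurable_fun Omega v ->
  (forall i, measurable_fun Omega (fun x => w x 0 i)) ->
  measurable_fun Omega (fun x => f x (u x) (v x) (w x)).
Proof.
move=> [mf cf] mu mv mw.
pose g k (x : Leb R n) : int * int * 'rV[int]_m :=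
  (dig k (u x), dig k (v x), \row_i dig k (w x 0 i)).
pose F k (c : int * int * 'rV[int]_m) (x : Leb R n) :=
  f x (app k c.1.1) (app k c.1.2) (\row_i app k (c.2 0 i)).
apply: (@ae_cvg_measurable _ _ _ (leb n) Omega (@leb_complete R n)
  (fun k x => F k (g k x) x)).
  move=> k; apply: measurable_fun_countable => [[[a b] c]|c]; last exact: mf.
  have -> : Omega `&` [set x | g k x = (a, b, c)] =
      (Omega `&` [set x | dig k (u x) = a]) `&`
      ((Omega `&` [set x | dig k (v x) = b]) `&`
       (Omega `&` \bigcap_(i in [set: 'I_m])
          (Omega `&` [set x | dig k (w x 0 i) = c 0 i]))).
    apply/seteqP; split => [x [Ox [xa xb xc]]|x [[Ox xa] [[_ xb] [_ xc]]]].
      split; first by [].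
      split; first by [].
      by split => // i _; split => //=; rewrite -xc mxE.
    split => //=; rewrite /g xa xb; congr (_, _, _).
    by apply/rowP => i; rewrite mxE; have [] := xc i I.
  apply: measurableI; first exact: measurable_floor_fiber.
  apply: measurableI; first exact: measurable_floor_fiber.
  apply: measurableI => //; apply: fin_bigcap_measurable => // i _.
  exact: measurable_floor_fiber.
apply: filterS cf => x + Ox => /(_ Ox) cfx.
have cvg t : (fun k => app k (dig k t)) @ \oo --> t.
  by apply/cvgrPdist_lt => e /floor_approx_cvg; apply: filterS => k; exact.
have cvgw : (fun k => \row_i app k ((\row_i dig k (w x 0 i)) 0 i)) @ \oo --> w x.
  apply/cvg_ballP => e e0; have := floor_approx_cvg e0; apply: filterS => k h.
  split => // i j; rewrite (ord1 i) !mxE; exact: h.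
exact: (cvg_comp _ _ (cvg_pair (cvg_pair (cvg (u x)) (cvg (v x))) cvgw)
  (cfx (u x, v x, w x))).
Qed.

End floor_approx.

(** * Spectral operators and energies *)

Section spectral.
Context d (T : measurableType d) (R : realType) (mu : {measure set T -> \bar R}).
Variables (D : set T).
Hypotheses (cmu : measure_is_complete mu) (mD : measurable D).
Variable z : nat -> T -> R.

Local Notation L2 := (sq_integrable mu D).
Local Notation dot := (dotL2 mu D).
Local Notation nrm2 := (sqnorm mu D).
Local Notation Int f := (mu.-integrable D (fun x => (f x)%:E)).

Hypothesis L2z : forall k, L2 (z k).
Hypothesis zz : forall j k, dot (z j) (z k) = (j == k)%:R.
Hypothesis z_complete : forall f, L2 f -> (forall k, dot f (z k) = 0) ->
  f = cst 0 %[ae mu in D].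

Variables (lam : nat -> R) (s0 : R).
Hypotheses (s0_ge0 : 0 <= s0) (lam_ge : forall k, s0 <= lam k ^+ 2).

(** The domain of the diagonal operator with multipliers lam, expressed by an image h in L^2 instead
    of summability of the squared coefficients of that image. *)
Definition spectral_dom : set (T -> R^o) := [set f : T -> R^o | L2 f /\
  exists h, L2 h /\ forall k, dot h (z k) = dot f (z k) * lam k].

Variable L : (T -> R) -> T -> R.
Hypothesis LP : forall f, spectral_dom f ->
  L2 (L f) /\ forall k, dot (L f) (z k) = dot f (z k) * lam k.

Definition graph_quad (f : T -> R^o) : R := nrm2 f + nrm2 (L f).

Local Notation dom := spectral_dom.
Local Notation q := graph_quad.

Lemma dom_L2 f : dom f -> L2 f. Proof. by case. Qed.

Lemma L_L2 f : dom f -> L2 (L f). Proof. by case/LP. Qed.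

Lemma L_unique f h : dom f -> L2 h ->
  (forall k, dot h (z k) = dot f (z k) * lam k) -> L f = h %[ae mu in D].
Proof.
move=> df L2h hz; have [L2L Lz] := LP df.
by apply: (ae_eq_coef mD L2z z_complete L2L L2h) => k; rewrite Lz hz.
Qed.

Lemma sqnorm_spectral_unique f h : dom f -> L2 h ->
  (forall k, dot h (z k) = dot f (z k) * lam k) -> nrm2 (L f) = nrm2 h.
Proof.
move=> df L2h hz; have e := L_unique df L2h hz.
by apply: (ae_eq_dotL2 cmu mD e e); exact: L_L2.
Qed.

(** Both arguments of the norm have the same coefficients, so they agree a.e., though not as
    functions. *)
Lemma dom_lin t (f g : T -> R^o) : dom f -> dom g -> dom (t *: f + g) /\
  nrm2 (L (t *: f + g)) = nrm2 (fun x => t * L f x + L g x).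
Proof.
move=> df dg; have [[L2f _] [L2g _]] := (df, dg).
have [L2Lf Lf] := LP df; have [L2Lg Lg] := LP dg.
have hz k : dot (fun x => t * L f x + L g x) (z k) =
            dot (t *: f + g) (z k) * lam k.
  rewrite dotL2_linl// Lf Lg -[X in _ = X * _]/(dot (fun x => t * f x + g x) (z k)).
  by rewrite dotL2_linl//; ring.
have L2l := sq_integrable_lin mD t L2Lf L2Lg.
have dl : dom (t *: f + g).
  by split; [exact: (sq_integrable_lin mD t L2f L2g)|exists (fun x => t * L f x + L g x)].
by split => //; exact: sqnorm_spectral_unique.
Qed.

Lemma dom0 : dom 0.
Proof.
split; first exact: sq_integrable0.
exists (fun=> 0); split; first exact: sq_integrable0.
have z0 k : dot (fun=> 0) (z k) = 0.
  rewrite -[RHS](mul0r (dot (z k) (z k))) -dotL2_scalel//.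
  by apply: eq_Rintegral => x _; rewrite !mul0r.
by move=> k; rewrite -[dot 0 _]/(dot (fun=> 0) _) z0 mul0r.
Qed.

Lemma sqnorm0 : nrm2 (fun=> 0) = 0.
Proof.
rewrite -[RHS](mul0r (nrm2 (fun=> 0))) -[X in X * _](expr0n R 2) -sqnorm_scale//.
  by apply: eq_Rintegral => x _; rewrite !mul0r.
exact: sq_integrable0.
Qed.

Lemma graph_quad0 : q 0 = 0.
Proof.
rewrite /graph_quad -[nrm2 0]/(nrm2 (fun=> 0)) sqnorm0 add0r.
have := (dom_lin (-1) dom0 dom0).2; rewrite scaler0 addr0 => ->.
rewrite -[RHS]sqnorm0; apply: eq_Rintegral => x _; ring.
Qed.

Lemma graph_quad_ge0 f : 0 <= q f.
Proof. by rewrite addr_ge0// sqnorm_ge0. Qed.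

Lemma sqnorm_spectral_sub (f g : T -> R^o) : dom f -> dom g ->
  nrm2 (L (f - g)) = nrm2 (fun x => L f x - L g x).
Proof.
move=> df dg; rewrite addrC -scaleN1r (dom_lin (-1) dg df).2.
by apply: eq_Rintegral => x _; ring.
Qed.

Lemma graph_quad_sub_cvg (f_ : nat -> T -> R^o) (f : T -> R^o) :
  (forall k, dom (f_ k)) -> dom f -> quad_cvg q f_ f ->
  (forall e, 0 < e -> exists N, forall k, (N <= k)%N ->
     nrm2 (fun x => f_ k x - f x) < e) /\
  (forall e, 0 < e -> exists N, forall k, (N <= k)%N ->
     nrm2 (fun x => L (f_ k) x - L f x) < e).
Proof.
move=> df_ df ff; split=> e /ff[N hN]; exists N => k /hN; apply: le_lt_trans.
  by rewrite /graph_quad lerDl sqnorm_ge0.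
by rewrite /graph_quad -sqnorm_spectral_sub// lerDr sqnorm_ge0.
Qed.

Lemma graph_quad_hilbert : hilbert_quad dom q.
Proof.
split; first exact: dom0.
- by move=> t x y dx dy; have [] := dom_lin t dx dy.
- split; first by move=> x _; exact: graph_quad_ge0.
  move=> t x dx; rewrite -[t *: x]addr0 /graph_quad (dom_lin t dx dom0).2.
  have L2x := dom_L2 dx; have L2Lx := L_L2 dx; have L2L0 := L_L2 dom0.
  have L0 : nrm2 (L 0) = 0.
    have := graph_quad0; rewrite /graph_quad.
    by have := sqnorm_ge0 mu D 0; have := sqnorm_ge0 mu D (L 0); lra.
  (* The representative L 0 is only known to have norm 0, so the cross term is removed by the
     Cauchy-Schwarz inequality. *)
  have d0 : dot (L x) (L 0) = 0.
    have := cauchy_schwarz mD L2Lx L2L0; rewrite L0 mulr0 => h.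
    by apply/eqP; rewrite -sqrf_eq0 eq_le h sqr_ge0.
  have -> : nrm2 (t *: x + 0) = t ^+ 2 * nrm2 x by rewrite addr0 -sqnorm_scale.
  by rewrite sqnorm_lin// L0 d0; ring.
- move=> t x y dx dy; rewrite /graph_quad sqnorm_spectral_sub//.
  have dty : dom ((1 - t) *: y).
    by rewrite -[_ *: y]addr0; have [] := dom_lin (1 - t) dy dom0.
  have -> : nrm2 (L (t *: x + (1 - t) *: y)) =
      nrm2 (fun a => t * L x a + (1 - t) * L y a).
    have [dl _] := dom_lin t dx dty; have [L2x _] := dx; have [L2y _] := dy.
    have [L2Lx Lx] := LP dx; have [L2Ly Ly] := LP dy.
    apply: sqnorm_spectral_unique => //.
      by apply: sq_integrable_lin => //; exact: sq_integrable_scale.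
    move=> k; rewrite -[X in _ = X * _]/(dot (fun a => t * x a + (1 - t) * y a) (z k)).
    rewrite !dotL2_linl ?dotL2_scalel ?Lx ?Ly//; try exact: sq_integrable_scale.
    by ring.
  have -> : nrm2 (t *: x + (1 - t) *: y) =
    t * nrm2 x + (1 - t) * nrm2 y - t * (1 - t) * nrm2 (x - y).
    by apply: sqnorm_conv => //; exact: dom_L2.
  by rewrite sqnorm_conv//; [ring|exact: L_L2|exact: L_L2].
- move=> x_ dx xc.
  have [||f L2f ff] := @sq_integrable_complete _ _ _ mu D cmu mD x_.
  + by move=> k; exact: dom_L2.
  + move=> e /xc[N hN]; exists N => j k Nj Nk; apply: le_lt_trans (hN _ _ Nj Nk).
    by rewrite /graph_quad lerDl sqnorm_ge0.
  have [||h L2h hh] := @sq_integrable_complete _ _ _ mu D cmu mD (fun k => L (x_ k)).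
  + by move=> k; exact: L_L2.
  + move=> e /xc[N hN]; exists N => j k Nj Nk; apply: le_lt_trans (hN _ _ Nj Nk).
    by rewrite /graph_quad -sqnorm_spectral_sub// lerDr sqnorm_ge0.
  (* Closedness of L: the relation between the coefficients of x_j and of L (x_j) passes to the
     limits f and h. *)
  have coef k : dot h (z k) = dot f (z k) * lam k.
    have h1 : (fun j => dot (z k) (L (x_ j))) @ \oo --> dot (z k) h.
      apply: dotL2_cvg => // e /hh[N hN]; exists N => j /hN; split => //.
      exact: L_L2.
    have h2 : (fun j => dot (z k) (x_ j) * lam k) @ \oo --> dot (z k) f * lam k.
      apply: cvgM; last exact: cvg_cst.
      apply: dotL2_cvg => // e /ff[N hN]; exists N => j /hN; split => //.
      exact: dom_L2.
    rewrite !(dotL2C mu D _ (z k)).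
    rewrite -(cvg_lim (@Rhausdorff R) h1) -(cvg_lim (@Rhausdorff R) h2).
    congr (lim (_ @ \oo)); apply/funext => j.
    by rewrite !(dotL2C mu D (z k)) (LP (dx j)).2.
  have df : dom f by split => //; exists h.
  have Lfh := L_unique df L2h coef.
  exists f => // e e0; have e2 : 0 < e / 2 by rewrite divr_gt0.
  have [N1 h1] := ff _ e2; have [N2 h2] := hh _ e2.
  exists (maxn N1 N2) => k; rewrite geq_max => /andP[/h1 k1 /h2 k2].
  rewrite /graph_quad sqnorm_spectral_sub//.
  have -> : nrm2 (fun x => L (x_ k) x - L f x) = nrm2 (fun x => L (x_ k) x - h x).
    have E : (fun x => L (x_ k) x - L f x) = (fun x => L (x_ k) x - h x) %[ae mu in D].
      by apply: filterS Lfh => x + Dx => ->.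
    by apply: ae_eq_dotL2 => //; apply: sq_integrable_sub => //; exact: L_L2.
  by rewrite -[nrm2 (x_ k - f)]/(nrm2 (fun x => x_ k x - f x)); lra.
Qed.

(** The squared coefficients of L f are at least s0 times those of f: apply Bessel's inequality to L
    f and Parseval's identity to f. *)
Lemma sqnorm_spectral_ge f : dom f -> s0 * nrm2 f <= nrm2 (L f).
Proof.
move=> df; have [L2L Lz] := LP df; have [L2f _] := df.
have [s0z|s0p] := eqVneq s0 0; first by rewrite s0z mul0r sqnorm_ge0.
have s0gt : 0 < s0 by rewrite lt_neqAle eq_sym s0p.
rewrite mulrC -ler_pdivlMr//; apply: (parseval_le cmu mD L2z zz z_complete L2f).
move=> n; rewrite ler_pdivlMr// mulr_suml.
apply: le_trans (bessel mD L2z zz n L2L).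
by apply: ler_sum => k _; rewrite Lz exprMn ler_wpM2l// sqr_ge0.
Qed.

Lemma integrable_quadratic (b : R) (beta gamma v : T -> R) :
  L2 beta -> Int gamma -> L2 v ->
  Int (fun x => b * v x ^+ 2 + beta x * v x + gamma x) /\
  \int[mu]_(x in D) (b * v x ^+ 2 + beta x * v x + gamma x) =
    b * nrm2 v + dot beta v + \int[mu]_(x in D) gamma x.
Proof.
move=> L2b Ig L2v; have I1 : Int (fun x => v x ^+ 2) by case: L2v.
have I2 := sq_integrable_mul mD L2b L2v.
have I1b := integrableZl_EFin mD b I1; have I12 := integrableD_EFin mD I1b I2.
split; first exact: integrableD_EFin.
rewrite RintegralD// RintegralD// RintegralZl//.
Qed.

Definition spectral_energy (g : T -> R -> R) (v : T -> R^o) : R :=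
  2^-1 * nrm2 (L v) + \int[mu]_(x in D) g x (v x).

(** The constants are chosen before g, which is what makes the bound uniform in w. *)
Lemma energy_coercive (b : R) (beta gamma : T -> R) :
  2 * b < s0 -> L2 beta -> Int gamma ->
  exists c C : R, 0 < c /\ forall (g : T -> R -> R) v,
    dom v -> Int (fun x => g x (v x)) ->
    (\forall x \ae mu, D x ->
      - b * `|v x| ^+ 2 - beta x * v x - gamma x <= g x (v x)) ->
    c * q v - C <= spectral_energy g v.
Proof.
move=> bs L2b Ig.
have s1 : 0 < 1 + s0 by rewrite ltr_pwDl.
(* From c <= 1/2 and s0 |v|^2 <= |L v|^2, the quantity 1/2 |L v|^2 - b |v|^2 - c (|v|^2 + |L v|^2)
   is at least (s0 / 2 - b - c (1 + s0)) |v|^2, which is nonnegative for c <= del. *)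
pose del := (s0 / 2 - b) / (1 + s0).
have del0 : 0 < del by rewrite divr_gt0//; lra.
pose c := Num.min 2^-1 del.
have c0 : 0 < c by rewrite lt_min del0 invr_gt0 ltr0n.
have c1 : c <= 2^-1 by rewrite ge_min lexx.
have c2 : c * (1 + s0) <= s0 / 2 - b by rewrite -ler_pdivlMr// ge_min lexx orbT.
exists (c / 2), (nrm2 beta / (2 * c) + \int[mu]_(x in D) gamma x).
split; first by rewrite divr_gt0.
move=> g v dv Igv lb; have L2v := dom_L2 dv.
have [IQ EQ] := integrable_quadratic b L2b Ig L2v.
have low : - (b * nrm2 v + dot beta v + \int[mu]_(x in D) gamma x) <=
    \int[mu]_(x in D) g x (v x).
  rewrite -EQ -mulN1r -RintegralZl//; apply: (ae_le_Rintegral cmu mD _ Igv).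
    exact: integrableZl_EFin.
  apply: filterS lb => x + Dx => /(_ Dx).
  by rewrite real_normK ?num_real//; lra.
(* Half of the coercivity constant c is spent on absorbing the linear term, hence the final c /
   2. *)
have young : dot beta v <= c / 2 * nrm2 v + nrm2 beta / (2 * c).
  have := sqnorm_ge0 mu D (fun x => (- c) * v x + beta x).
  rewrite sqnorm_lin// (dotL2C mu D v beta) => h.
  rewrite -(ler_pM2l c0) mulrDr [c * (_ / _)](_ : _ = nrm2 beta / 2); first lra.
  by field; rewrite gt_eqF.
have ge := sqnorm_spectral_ge dv.
have : c * (nrm2 v + nrm2 (L v)) <= 2^-1 * nrm2 (L v) - b * nrm2 v.
  have : (2^-1 - c) * (s0 * nrm2 v) <= (2^-1 - c) * nrm2 (L v).
    by rewrite ler_wpM2l// subr_ge0.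
  have : c * (1 + s0) * nrm2 v <= (s0 / 2 - b) * nrm2 v.
    by rewrite ler_wpM2r// sqnorm_ge0.
  move: (nrm2 v) (nrm2 (L v)) => N S; lra.
have : 0 <= c * nrm2 (L v) by rewrite mulr_ge0 ?sqnorm_ge0// ltW.
rewrite /spectral_energy /graph_quad; move: low young.
set K := nrm2 beta / (2 * c); set I1 := Rintegral _ _ _; set I2 := Rintegral _ _ _.
by clearbody K I1 I2; lra.
Qed.

(* Fatou's lemma applied to g(v_k) + b v_k^2 + beta v_k + gamma along an a.e.
   convergent subsequence. *)
Lemma energy_lower_semicts (b : R) (beta gamma : T -> R) (g : T -> R -> R) :
  L2 beta -> Int gamma ->
  (\forall x \ae mu, D x -> continuous (g x)) ->
  (forall v, dom v -> Int (fun x => g x (v x))) ->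
  (\forall x \ae mu, D x -> forall t : R,
      - b * `|t| ^+ 2 - beta x * t - gamma x <= g x t) ->
  lower_semicts dom q (spectral_energy g).
Proof.
move=> L2b Ig cg Igv lb.
apply: cvg_lower_semicts => v_ v c dv_ dv vv vc.
have [vL2 vLL2] := graph_quad_sub_cvg dv_ dv vv.
have L2v_ k := dom_L2 (dv_ k); have L2v := dom_L2 dv.
have [s sk sv] := sqnorm_cvg_ae_subseq mD L2v_ L2v vL2.
(* Up to the integral of gamma, the energy plus r is the integral of the nonnegative g + Q. Since r
   is continuous for q, bounds on the energy pass to that integral and back. *)
pose r (f : T -> R^o) := b * nrm2 f + dot beta f - 2^-1 * nrm2 (L f).
have rcvg : (fun k => r (v_ k)) @ \oo --> r v.
  apply: cvgB; last first.
    apply: cvgM; first exact: cvg_cst.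
    by apply: sqnorm_cvg vLL2 => // [|k]; exact: L_L2.
  apply: cvgD; first by apply: cvgM; [exact: cvg_cst|exact: sqnorm_cvg vL2].
  by apply: dotL2_cvg => // e /vL2[N hN]; exists N => k /hN.
pose Q (f : T -> R^o) x := b * f x ^+ 2 + beta x * f x + gamma x.
have IQ f : dom f -> Int (Q f).
  by move=> df; exact: (integrable_quadratic b L2b Ig (dom_L2 df)).1.
have EQ f : dom f -> \int[mu]_(x in D) Q f x =
    b * nrm2 f + dot beta f + \int[mu]_(x in D) gamma x.
  by move=> df; exact: (integrable_quadratic b L2b Ig (dom_L2 df)).2.
have RE f : dom f -> \int[mu]_(x in D) (g x (f x) + Q f x) =
    spectral_energy g f + r f + \int[mu]_(x in D) gamma x.
  move=> df; rewrite RintegralD//; [|exact: Igv|exact: IQ].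
  by rewrite EQ// /spectral_energy /r; ring.
apply/ler_addgt0Pr => e e0.
move/cvgrPdist_lt : rcvg => /(_ e e0)[K _ hK].
(* The shift by K makes r (v_k) < r v + e hold for all terms, since [fatou_EFin] takes a bound valid
   at every index. *)
have dvs k : dom (v_ (s (k + K)%N)) by exact: dv_.
have [||||_ le] := @fatou_EFin _ _ _ mu cmu D mD
  (fun k x => g x (v_ (s (k + K)%N) x) + Q (v_ (s (k + K)%N)) x)
  (fun x => g x (v x) + Q v x) (c + (r v + e) + \int[mu]_(x in D) gamma x).
- by move=> k; apply: integrableD_EFin => //; [exact: Igv|exact: IQ].
- move=> k; apply: filterS lb => x + Dx => /(_ Dx (v_ (s (k + K)%N) x)).
  by rewrite real_normK ?num_real// /Q; lra.
- apply: filterS2 sv cg => x + + Dx => /(_ Dx) vx /(_ Dx) gx.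
  have vxK : (fun k => v_ (s (k + K)%N) x) @ \oo --> v x.
    by rewrite (cvg_shiftn K (fun k => v_ (s k) x)).
  apply: cvgD; first exact: (cvg_comp _ _ vxK (gx _)).
  apply: cvgD; last exact: cvg_cst.
  apply: cvgD; last by apply: cvgM => //; exact: cvg_cst.
  by apply: cvgM; [exact: cvg_cst|exact: cvgM].
- move=> k; rewrite RE// lerD2r lerD//.
  have := hK (s (k + K)%N) (leq_trans (leq_addl k K) (sk _)).
  by rewrite /= ltr_norml => /andP[h _]; lra.
by move: le; rewrite RE// lerD2r; lra.
Qed.

End spectral.

(** * The fractional Laplacian and the functional *)

Section fractional_laplacian.
Context {R : realType} {n : nat}.
Variables (Omega : set (Leb R n)) (z : nat -> Leb R n -> R) (rho : nat -> R).
Variable alpha : R.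
Hypothesis oO : open (Omega : set 'rV[R]_n).
Hypothesis eigen : dirichlet_eigensystem Omega z rho.

Local Notation L2 := (sq_integrable (leb n) Omega).
Local Notation dot := (dotL2 (leb n) Omega).
Local Notation nrm2 := (sqnorm (leb n) Omega).

Definition frac_mult k := rho k `^ (alpha / 4).
Local Notation dom := (spectral_dom (leb n) Omega z frac_mult).
Local Notation La := (frac_lap Omega z rho (alpha / 4)).

Let mO : measurable Omega. Proof. exact: open_measurable_leb. Qed.

Let cleb : measure_is_complete (leb n : set (Leb R n) -> \bar R).
Proof. exact: leb_complete. Qed.

Lemma eigenfunction_L2 k : L2 (z k).
Proof.
by have [/(_ k) [_ [g [[/(Lp2P mO) ? _ _] _]]] _ _ _] := eigen.
Qed.
Let L2z := eigenfunction_L2.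

Lemma eigenfunction_dot j k : dot (z j) (z k) = (j == k)%:R.
Proof. by have [_ + _ _] := eigen; exact. Qed.
Let zz := eigenfunction_dot.

Lemma eigenfunction_complete f : L2 f -> (forall k, dot f (z k) = 0) ->
  f = cst 0 %[ae leb n in Omega].
Proof. by move=> /(Lp2P mO); have [_ _ + _] := eigen; exact. Qed.
Let zc := eigenfunction_complete.

Lemma frac_mult_sqr k : frac_mult k ^+ 2 = rho k `^ (alpha / 2).
Proof.
rewrite -powR_mulrn ?powR_ge0// /frac_mult -powRrM; by congr (_ `^ _); field.
Qed.

(** The power is monotone on nonnegative reals, whence the use of [eigenvalue_ge0]. *)
Lemma frac_mult_ge k : 0 <= alpha -> rho 0%N `^ (alpha / 2) <= frac_mult k ^+ 2.
Proof.
have [ef _ _ /(_ k) rho_ge] := eigen.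
have rho0 j : 0 <= rho j by apply: eigenvalue_ge0 (ef j).
by move=> a0; rewrite frac_mult_sqr ge0_ler_powR// ?nnegrE// divr_ge0.
Qed.

Lemma L2_expansionP a f : L2_expansion Omega z a f <->
  L2 f /\ forall k, dot f (z k) = a k.
Proof.
have L2p a' N : L2 (psum z a' N) := sq_integrable_psum mO L2z a' N.
split=> [[/(Lp2P mO) L2f /(L2_cvgP mO (L2p a) L2f) cvgf]|[L2f fa]].
  split => // k; apply: (dot_lim mO L2z zz (L2p a) L2f cvgf).
  by exists k.+1 => j kj; rewrite (dot_psum_z mO L2z zz) kj.
split; first exact/(Lp2P mO).
apply/(L2_cvgP mO (L2p a) L2f).
have -> : a = (fun k => dot f (z k)) by apply/funext => k; rewrite fa.
exact: (psum_cvg cleb mO L2z zz zc L2f).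
Qed.

(** The series defining the space is the sum of the squares of a_k rho_k^(alpha/4). If it is finite,
    [riesz_fischer] yields the image h; conversely Parseval's identity for h gives its value. *)
Lemma frac_sobolevE : frac_sobolev Omega z rho alpha = dom.
Proof.
have t0 (a : nat -> R) k : (0 <= (a k ^+ 2 * rho k `^ (alpha / 2))%:E)%E.
  by rewrite lee_fin mulr_ge0 ?sqr_ge0 ?powR_ge0.
apply/seteqP; split => f.
  move=> [a [/L2_expansionP[L2f fa] fin]]; split => //.
  pose C := fine (\sum_(k <oo) (a k ^+ 2 * rho k `^ (alpha / 2))%:E)%E.
  have bnd N : \sum_(k < N) (a k * frac_mult k) ^+ 2 <= C.
    rewrite -lee_fin fineK; last by rewrite ge0_fin_numE//; apply: nneseries_ge0.
    under eq_bigr do rewrite exprMn frac_mult_sqr.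
    rewrite -sumEFin -(big_mkord xpredT (fun k => (a k ^+ 2 * rho k `^ (alpha / 2))%:E)).
    exact: nneseries_lim_ge.
  have [h [L2h hz _]] := @riesz_fischer _ _ _ _ _ cleb mO z L2z zz
    (fun k => a k * frac_mult k) C bnd.
  by exists h; split => // k; rewrite hz fa.
move=> [L2f [h [L2h hz]]]; exists (fun k => dot f (z k)); split.
  exact/L2_expansionP.
rewrite (eq_eseriesr (g := fun k => (dot h (z k) ^+ 2)%:E)); last first.
  by move=> k _; rewrite hz exprMn frac_mult_sqr.
by rewrite (parseval_nneseries cleb mO L2z zz zc L2h) ltry.
Qed.

Lemma frac_lapP f : dom f -> L2 (La f) /\
  forall k, dot (La f) (z k) = dot f (z k) * frac_mult k.
Proof.
move=> [L2f [h [L2h hz]]]; apply/L2_expansionP.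
(* The set of expansions contains h, so [xget] returns one of its elements, not the default. *)
rewrite /frac_lap; apply: (xgetPex (cst 0)); exists h; exact/L2_expansionP.
Qed.

Lemma frac_sobolev_normE f : dom f ->
  frac_sobolev_norm Omega z rho alpha f = Num.sqrt (nrm2 (La f)).
Proof.
move=> df; have [L2L Lz] := frac_lapP df; congr Num.sqrt.
rewrite (eq_eseriesr (g := fun k => (dot (La f) (z k) ^+ 2)%:E)); last first.
  by move=> k _; rewrite Lz exprMn frac_mult_sqr.
by rewrite (parseval_nneseries cleb mO L2z zz zc L2L).
Qed.

End fractional_laplacian.

(** * The functional F_w and its saddle points *)

Lemma convex_function_mod (R : realType) (V : lmodType R) (H : set V)
    (q phi : V -> R) :
  convex_function H (phi : convex_lmodType V -> R^o) -> convex_mod H q 0 phi.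
Proof.
move=> cphi t x y Hx Hy /andP[t0 t1].
by have := cphi (Itv01 t0 t1) x y (mem_set Hx) (mem_set Hy); rewrite mul0r subr0.
Qed.

(** Used at a saddle point (u, v) with f1, f, f2 the values at (0, v), (u, v), (u, 0), and with a +
    b and a' + b' the squared graph norms of u and v, where b and b' come from the fractional
    Laplacian. The absolute value and the 1 make the radius positive and the bounds strict. *)
Lemma coercive_radius (R : rcfType) (c C a b a' b' f1 f f2 : R) : 0 < c ->
  0 <= a -> 0 <= b -> 0 <= a' -> 0 <= b' ->
  c * (a' + b') - C <= f1 -> f1 <= f -> f <= f2 -> f2 <= C - c * (a + b) ->
  Num.sqrt b < Num.sqrt (`|2 * C / c| + 1) /\
  Num.sqrt b' < Num.sqrt (`|2 * C / c| + 1).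
Proof.
move=> c0 a0 b0 a'0 b'0 h1 h2 h3 h4.
have K0 : 0 < `|2 * C / c| + 1 by rewrite ltr_wpDl.
have : (a + b) + (a' + b') <= 2 * C / c by rewrite ler_pdivlMr//; lra.
move=> /le_trans/(_ (ler_norm _)); rewrite !ltr_sqrt//.
by move: (`|_|) => K hK; split; lra.
Qed.

Section functional.
Context {R : realType} {n m : nat}.
Variables (Omega : set (Leb R n)) (z : nat -> Leb R n -> R) (rho : nat -> R).
Variables (alpha : R) (p : \bar R) (M : set 'rV[R]_m).
Variable G : Leb R n -> R -> R -> 'rV[R]_m -> R.
Hypothesis oO : open (Omega : set 'rV[R]_n).
Hypothesis eigen : dirichlet_eigensystem Omega z rho.
Hypothesis alpha_ge0 : 0 <= alpha.
Hypothesis carG : caratheodory_fun Omega G.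

Local Notation L2 := (sq_integrable (leb n) Omega).
Local Notation nrm2 := (sqnorm (leb n) Omega).
Local Notation Int f := ((leb n).-integrable Omega (fun x => (f x)%:E)).
Local Notation La := (frac_lap Omega z rho (alpha / 4)).
Local Notation dom := (spectral_dom (leb n) Omega z (frac_mult rho alpha)).
Local Notation q := (graph_quad (leb n) Omega La).
Local Notation F := (functional Omega z rho alpha G).
Local Notation W := (admissible Omega p M).
Local Notation s0 := (rho 0%N `^ (alpha / 2)).
Local Notation energy := (spectral_energy (leb n) Omega La).

(* (A3) and (A4) for the functions of the spectral domain. *)
Hypothesis lowG : forall u, dom u -> exists (b : R) (beta gamma : Leb R n -> R),
  [/\ 2 * b < s0, L2 beta, Int gamma &
    \forall x \ae leb n, Omega x -> forall v w, M w ->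
      - b * `|v| ^+ 2 - beta x * v - gamma x <= G x (u x) v w].
Hypothesis highG : forall v, dom v -> exists (B : R) (beta gamma : Leb R n -> R),
  [/\ 2 * B < s0, L2 beta, Int gamma &
    \forall x \ae leb n, Omega x -> forall u w, M w ->
      G x u (v x) w <= B * `|u| ^+ 2 + beta x * u + gamma x].

Let mO : measurable Omega. Proof. exact: open_measurable_leb. Qed.

Let cleb : measure_is_complete (leb n : set (Leb R n) -> \bar R).
Proof. exact: leb_complete. Qed.

Let L2z := eigenfunction_L2 oO eigen.
Let zz := eigenfunction_dot eigen.
Let zc := eigenfunction_complete oO eigen.
Let LP f (df : dom f) := frac_lapP oO eigen df.
Let lam_ge k := frac_mult_ge oO eigen k alpha_ge0.
Let s0_ge0 : 0 <= s0. Proof. exact: powR_ge0. Qed.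

Lemma integrable_G w u v : W w -> dom u -> dom v ->
  Int (fun x => G x (u x) (v x) (w x)).
Proof.
move=> [[mw _] Mw] du dv.
have [b [be [ga [_ L2be Iga low]]]] := lowG du.
have [B [be' [ga' [_ L2be' Iga' high]]]] := highG dv.
have [L2u _] := du; have [L2v _] := dv.
have [Il _] := integrable_quadratic mO b L2be Iga L2v.
have [Ih _] := integrable_quadratic mO B L2be' Iga' L2u.
apply: (integrable_between cleb mO _ (integrableZl_EFin mO (-1) Il) Ih).
  by apply: (measurable_caratheodory_comp mO carG) => //; [case: L2u|case: L2v].
apply: filterS3 Mw low high => x + + + Ox => /(_ Ox) Mx.
move=> /(_ Ox)/(_ (v x) _ Mx) + /(_ Ox)/(_ (u x) _ Mx).
by rewrite !real_normK ?num_real// => h1 h2; apply/andP; split; lra.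
Qed.

Lemma functionalE w u v : W w -> dom u -> dom v ->
  F w u v = energy (fun x t => G x (u x) t (w x)) v - 2^-1 * nrm2 (La u).
Proof.
move=> Ww du dv; have IG := integrable_G Ww du dv.
rewrite /functional (Rintegral_sqr_comb mO _ _ (LP dv).1 (LP du).1 IG).
by rewrite addrAC.
Qed.

(** Exchanging u and v and replacing G by - G gives an energy of the same shape, for which (A4) is
    the lower bound; the concave side thus falls under the same energy lemmas. *)
Lemma functionalN w u v : W w -> dom u -> dom v ->
  - F w u v = energy (fun x t => - G x t (v x) (w x)) u - 2^-1 * nrm2 (La v).
Proof.
move=> Ww du dv; have IG := integrable_G Ww du dv.
rewrite functionalE// /spectral_energy.
rewrite (RintegralN mO IG).
have swap (a b c : R) : - (a + c - b) = b - c - a by ring.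
exact: swap.
Qed.

Lemma G_continuous w u v : \forall x \ae leb n, Omega x ->
  continuous (fun t => G x (u x) t (w x)) /\
  continuous (fun t => - G x t (v x) (w x)).
Proof.
case: carG => _; apply: filterS => x + Ox => /(_ Ox) cG; split=> t.
  have h : (fun s => ((u x, s), w x)) @ t --> ((u x, t), w x).
    exact: (cvg_pair (cvg_pair (cvg_cst (u x)) cvg_id) (cvg_cst (w x))).
  exact: (cvg_comp _ _ h (cG _)).
have h : (fun s => ((s, v x), w x)) @ t --> ((t, v x), w x).
  exact: (cvg_pair (cvg_pair cvg_id (cvg_cst (v x))) (cvg_cst (w x))).
by apply: cvgN; exact: (cvg_comp _ _ h (cG _)).
Qed.

Lemma functional_lower_semicts w u : W w -> dom u -> lower_semicts dom q (F w u).
Proof.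
move=> Ww du; have [b [be [ga [_ L2be Iga low]]]] := lowG du.
apply: (eq_lower_semicts (fun v dv => esym (functionalE Ww du dv))).
apply: lower_semictsD; last exact: lower_semicts_cst.
apply: (energy_lower_semicts cleb mO L2z zc LP (b := b) L2be Iga).
- by apply: filterS (G_continuous w u u) => x + Ox => /(_ Ox)[].
- by move=> v dv; exact: integrable_G.
- have [_ Mw] := Ww; apply: filterS2 Mw low => x + + Ox => /(_ Ox) Mx /(_ Ox) h t.
  exact: h.
Qed.

Lemma functionalN_lower_semicts w v : W w -> dom v ->
  lower_semicts dom q (fun u => - F w u v).
Proof.
move=> Ww dv; have [B [be [ga [_ L2be Iga high]]]] := highG dv.
apply: (eq_lower_semicts (fun u du => esym (functionalN Ww du dv))).
apply: lower_semictsD; last exact: lower_semicts_cst.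
apply: (energy_lower_semicts cleb mO L2z zc LP (b := B) L2be Iga).
- by apply: filterS (G_continuous w v v) => x + Ox => /(_ Ox)[].
- move=> u du; have := integrableZl_EFin mO (-1) (integrable_G Ww du dv).
  by congr integrable; apply/funext => x; rewrite mulN1r.
- have [_ Mw] := Ww; apply: filterS2 Mw high => x + + Ox => /(_ Ox) Mx /(_ Ox) h t.
  by have := h t _ Mx; lra.
Qed.

Lemma functional_coercive u : dom u -> exists c C : R, 0 < c /\
  forall w v, W w -> dom v -> c * q v - C <= F w u v.
Proof.
move=> du; have [b [be [ga [bs L2be Iga low]]]] := lowG du.
have [c [C [c0 h]]] := energy_coercive cleb mO L2z zz zc s0_ge0 lam_ge LP bs L2be Iga.
exists c, (C + 2^-1 * nrm2 (La u)); split => // w v Ww dv.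
rewrite functionalE// opprD addrA lerB// h//; first exact: integrable_G.
have [_ Mw] := Ww; apply: filterS2 Mw low => x + + Ox => /(_ Ox) Mx /(_ Ox) h' .
exact: h'.
Qed.

Lemma functionalN_coercive v : dom v -> exists c C : R, 0 < c /\
  forall w u, W w -> dom u -> c * q u - C <= - F w u v.
Proof.
move=> dv; have [B [be [ga [Bs L2be Iga high]]]] := highG dv.
have [c [C [c0 h]]] := energy_coercive cleb mO L2z zz zc s0_ge0 lam_ge LP Bs L2be Iga.
exists c, (C + 2^-1 * nrm2 (La v)); split => // w u Ww du.
rewrite functionalN// opprD addrA lerB// h//.
  have := integrableZl_EFin mO (-1) (integrable_G Ww du dv).
  by congr integrable; apply/funext => x; rewrite mulN1r.
have [_ Mw] := Ww; apply: filterS2 Mw high => x + + Ox => /(_ Ox) Mx /(_ Ox) h'.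
by have := h' (u x) _ Mx; lra.
Qed.

Lemma functional_uniformly_coercive : exists c C : R, 0 < c /\ forall w f,
  W w -> dom f -> c * q f - C <= F w 0 f /\ F w f 0 <= C - c * q f.
Proof.
have d0 : dom 0 := dom0 mO L2z (frac_mult rho alpha).
have [c1 [C1 [c10 h1]]] := functional_coercive d0.
have [c2 [C2 [c20 h2]]] := functionalN_coercive d0.
exists (Num.min c1 c2), (Num.max C1 C2); split; first by rewrite lt_min c10.
move=> w f Ww df; have := h1 w f Ww df; have := h2 w f Ww df.
have q0 : 0 <= q f := graph_quad_ge0 (leb n) Omega La f.
have : Num.min c1 c2 * q f <= c1 * q f by rewrite ler_wpM2r// ge_min lexx.
have : Num.min c1 c2 * q f <= c2 * q f by rewrite ler_wpM2r// ge_min lexx orbT.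
have : C1 <= Num.max C1 C2 by rewrite le_max lexx.
have : C2 <= Num.max C1 C2 by rewrite le_max lexx orbT.
move: (Num.min c1 c2 * q f) (Num.max C1 C2) (c1 * q f) (c2 * q f).
move: (F w 0 f) (F w f 0) => *.
by split; lra.
Qed.

Lemma functional_saddle w : W w -> concave_convex dom (F w) ->
  exists u v, saddle_point dom (F w) u v.
Proof.
move=> Ww [Fu Fv].
have Hq : hilbert_quad dom q := graph_quad_hilbert cleb mO L2z zc LP.
have [c [C [c0 cC]]] := functional_uniformly_coercive.
have qge0 f : 0 <= q f := graph_quad_ge0 (leb n) Omega La f.
have [||||u0 [v0 [du0 dv0 uv]]] := @convex_saddle _ _ _ _ Hq (F w) c C c0.
- move=> u du; split; first exact/convex_function_mod/Fv.
    exact: functional_lower_semicts.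
  have [c' [C' [c'0 h]]] := functional_coercive du.
  exists (- C') => v dv; apply: le_trans (h _ _ Ww dv).
  by rewrite lerDr mulr_ge0// ltW.
- move=> v dv; split; first exact/convex_function_mod/Fu.
    exact: functionalN_lower_semicts.
  have [c' [C' [c'0 h]]] := functionalN_coercive dv.
  exists (- C') => u du; apply: le_trans (h _ _ Ww du).
  by rewrite lerDr mulr_ge0// ltW.
- by move=> v dv; have [] := cC _ _ Ww dv.
- by move=> u du; have [] := cC _ _ Ww du.
by exists u0, v0; split => // u v du dv; split; exact: uv.
Qed.

Lemma functional_saddle_bounded : exists r : R, 0 < r /\ forall w u v, W w ->
  saddle_point dom (F w) u v ->
  Num.sqrt (nrm2 (La u)) < r /\ Num.sqrt (nrm2 (La v)) < r.
Proof.
have d0 : dom 0 := dom0 mO L2z (frac_mult rho alpha).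
have [c [C [c0 cC]]] := functional_uniformly_coercive.
have K0 : 0 < `|2 * C / c| + 1 by rewrite ltr_wpDl.
exists (Num.sqrt (`|2 * C / c| + 1)); split; first by rewrite sqrtr_gt0.
move=> w u v Ww [du dv uv].
have [F1 _] := uv _ _ d0 d0; have [_ F2] := uv _ _ d0 d0.
have [F3 _] := cC _ _ Ww dv; have [_ F4] := cC _ _ Ww du.
exact: (coercive_radius c0 (sqnorm_ge0 _ _ u) (sqnorm_ge0 _ _ (La u))
  (sqnorm_ge0 _ _ v) (sqnorm_ge0 _ _ (La v)) F3 F1 F2 F4).
Qed.

End functional.

(** The inequalities chain into F u' v <= F u v <= F u v' <= F u' v' <= F u' v, so the four values
    coincide. If u and u' differ, their midpoint exceeds the maximum of F . v by strict concavity;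
    likewise for v and v'. *)
Lemma saddle_point_unique (R : realType) (T : Type)
    (eqv : (T -> R^o) -> (T -> R^o) -> Prop) (H : set (T -> R^o))
    (F : (T -> R^o) -> (T -> R^o) -> R) u v u' v' :
  (forall t x y, H x -> H y -> H (t *: x + (1 - t) *: y)) ->
  strictly_concave_convex eqv H F ->
  saddle_point H F u v -> saddle_point H F u' v' -> eqv u u' /\ eqv v v'.
Proof.
move=> Hc [Fu Fv] [Hu Hv uv] [Hu' Hv' uv'].
have [a1 a2] := uv _ _ Hu' Hv'; have [b1 b2] := uv' _ _ Hu Hv.
have half : 0 < (2^-1 : R) < 1 by lra.
have half2 : 1 - 2^-1 = 2^-1 :> R by field.
split; apply: contrapT => ne.
  have [c1 _] := uv _ _ (Hc 2^-1 _ _ Hu Hu') Hv.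
  by have := Fu _ Hv _ _ _ Hu Hu' ne half; move: c1; rewrite half2; lra.
have [_ c2] := uv _ _ Hu (Hc 2^-1 _ _ Hv Hv').
by have := Fv _ Hu _ _ _ Hv Hv' ne half; move: c2; rewrite half2; lra.
Qed.

Theorem theorem1 (R : realType) (n m : nat) (Omega : set (Leb R n))
    (alpha : R) (z : nat -> Leb R n -> R) (rho : nat -> R)
    (p : \bar R) (M : set 'rV[R]_m)
    (G : Leb R n -> R -> R -> 'rV[R]_m -> R)
    (H := frac_sobolev Omega z rho alpha)
    (W := admissible Omega p M)
    (F := functional Omega z rho alpha G)
    (norm := frac_sobolev_norm Omega z rho alpha)
    (eqO := fun f g : Leb R n -> R => f = g %[ae leb n in Omega]) :
  (3 <= n)%N ->
  is_domain Omega -> bounded_set (Omega : set 'rV[R]_n) ->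
  lipschitz_boundary Omega ->
  1 < alpha < 2 ->
  dirichlet_eigensystem Omega z rho ->
  (1 <= p)%E ->
  convex_set M -> bounded_set M ->
  has_partials G Omega ->
  (* A1 *)
  caratheodory_fun Omega G ->
  caratheodory_fun Omega (partial_u G) ->
  caratheodory_fun Omega (partial_v G) ->
  (* A2 *)
  (exists s c : R, [/\ 1 < s < 2 * n%:R / (n%:R - alpha), 0 < c,
    p = +oo%E -> \forall x \ae leb n, Omega x -> forall u v w, M w ->
      [/\ `|G x u v w| <= c * (1 + `|u| `^ s + `|v| `^ s),
          `|partial_u G x u v w| <=
            c * (1 + `|u| `^ (s - 1) + `|v| `^ (s - 1)) &
          `|partial_v G x u v w| <=
            c * (1 + `|u| `^ (s - 1) + `|v| `^ (s - 1))] &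
    forall q : R, p = q%:E -> \forall x \ae leb n, Omega x -> forall u v w,
      [/\ `|G x u v w| <= c * (1 + `|u| `^ s + `|v| `^ s + enorm w `^ q),
          `|partial_u G x u v w| <=
            c * (1 + `|u| `^ (s - 1) + `|v| `^ (s - 1)
                 + enorm w `^ (q - q / s)) &
          `|partial_v G x u v w| <=
            c * (1 + `|u| `^ (s - 1) + `|v| `^ (s - 1)
                 + enorm w `^ (q - q / s))]]) ->
  (* A3 *)
  (forall u, H u -> exists (b : R) (beta gamma : Leb R n -> R),
    [/\ 2 * b < rho 0%N `^ (alpha / 2), Lp Omega 2%:E beta,
        Lp Omega 1%:E gamma &
        \forall x \ae leb n, Omega x -> forall v w, M w ->
          - b * `|v| ^+ 2 - beta x * v - gamma x <= G x (u x) v w]) ->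
  (* A4 *)
  (forall v, H v -> exists (B : R) (beta gamma : Leb R n -> R),
    [/\ 2 * B < rho 0%N `^ (alpha / 2), Lp Omega 2%:E beta,
        Lp Omega 1%:E gamma &
        \forall x \ae leb n, Omega x -> forall u w, M w ->
          G x u (v x) w <= B * `|u| ^+ 2 + beta x * u + gamma x]) ->
  (* A5 *)
  (forall w, W w -> concave_convex H (F w)) ->
  [/\ forall w, W w -> exists u v, saddle_point H (F w) u v,
      exists r1 r2 : R, [/\ 0 < r1, 0 < r2 &
        forall w u v, W w -> saddle_point H (F w) u v ->
          norm u < r1 /\ norm v < r2] &
      forall w, W w -> strictly_concave_convex eqO H (F w) ->
        forall u v u' v', saddle_point H (F w) u v ->
          saddle_point H (F w) u' v' -> eqO u u' /\ eqO v v'].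

Proof.
move=> _ [oO _ _] _ _ /andP[alpha1 _] eigen _ _ _ _ carG _ _ _ A3 A4 A5.
have a0 : 0 <= alpha by rewrite ltW// (lt_trans ltr01).
have mO : measurable Omega := open_measurable_leb oO.
have HE : H = spectral_dom (leb n) Omega z (frac_mult rho alpha).
  exact: (@frac_sobolevE R n Omega z rho alpha oO eigen).
have lowG u : H u -> exists (b : R) (beta gamma : Leb R n -> R),
    [/\ 2 * b < rho 0%N `^ (alpha / 2), sq_integrable (leb n) Omega beta,
        (leb n).-integrable Omega (fun x => (gamma x)%:E) &
        \forall x \ae leb n, Omega x -> forall v w, M w ->
          - b * `|v| ^+ 2 - beta x * v - gamma x <= G x (u x) v w].
  move=> /A3[b [be [ga [h1 /(Lp2P mO) h2 /(Lp1_integrable mO) h3 h4]]]].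
  by exists b, be, ga.
have highG v : H v -> exists (B : R) (beta gamma : Leb R n -> R),
    [/\ 2 * B < rho 0%N `^ (alpha / 2), sq_integrable (leb n) Omega beta,
        (leb n).-integrable Omega (fun x => (gamma x)%:E) &
        \forall x \ae leb n, Omega x -> forall u w, M w ->
          G x u (v x) w <= B * `|u| ^+ 2 + beta x * u + gamma x].
  move=> /A4[b [be [ga [h1 /(Lp2P mO) h2 /(Lp1_integrable mO) h3 h4]]]].
  by exists b, be, ga.
move: A5 lowG highG; rewrite HE => A5 lowG highG; split.
- move=> w Ww.
  exact: (functional_saddle oO eigen a0 carG lowG highG Ww (A5 w Ww)).
- have [r [r0 hr]] := functional_saddle_bounded p oO eigen a0 carG lowG highG.
  exists r, r; split => // w u v Ww uv.
  have [du dv _] := uv.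
  rewrite /norm !(frac_sobolev_normE oO eigen)//.
  exact: hr Ww uv.
- move=> w Ww scc u v u' v' uv uv'.
  apply: (saddle_point_unique _ scc uv uv').
  have Hq := graph_quad_hilbert (@leb_complete R n) mO (eigenfunction_L2 oO eigen)
    (eigenfunction_complete oO eigen) (frac_lapP oO eigen (alpha := alpha)).
  exact: (quad_mem_conv Hq).
Qed.
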